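(* Let $T$ be an integral domain, $M$ a maximal ideal of $T$, $K=T/M$, $\varphi:T\to K$ the canonical epimorphism, $D$ a proper subring of $K$, $k$ the quotient field of $D$ (taken inside $K$), and $R=\varphi^{-1}(D)$. Then the following assertions hold. (1) $R$ is a locally weakly Krull domain if and only if $D$ is a field, $T$ is a locally weakly Krull domain and ${\rm ht}(M)=1$. (2) $R$ is a locally infra-Krull domain if and only if $D$ is a field, $T$ is a locally infra-Krull domain, ${\rm ht}(M)=1$ and $[K:k]$ is finite. (3) $R$ is a locally Krull-type domain if and only if $D$ is a locally Bézout domain, $T$ is a locally Krull-type domain, $T_M$ is a valuation domain and $k=K$.
   Context: For a property $\mathcal{X}$ of integral domains, a domain $D$ is a locally $\mathcal{X}$-domain if $D_P$ has $\mathcal{X}$ for every prime ideal $P$ of $D$. Let $X^1(D)$ be the set of height-one prime ideals of $D$. For a set $\mathfrak{A}$ of prime ideals of $D$ consider: (i) $D=\bigcap_{P\in\mathfrak{A}}D_P$ (an empty intersection being the quotient field of $D$); (ii) $D_P$ is a Noetherian domain for all $P\in\mathfrak{A}$; (iii) $D_P$ is a valuation domain for all $P\in\mathfrak{A}$; (v) every nonzero element of $D$ belongs to only finitely many members of $\mathfrak{A}$. $D$ is a weakly Krull domain if (i) and (v) hold for $\mathfrak{A}=X^1(D)$; an infra-Krull domain if (i), (ii) and (v) hold for $\mathfrak{A}=X^1(D)$; a Krull-type domain if (i), (iii) and (v) hold for some set $\mathfrak{A}$ of prime ideals of $D$. A Bézout domain is a domain whose finitely generated ideals are principal. Fields count as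 valuation domains.
   Formalization: M is assumed to be nonzero (T is not a field); for M = 0 the assertions fail, e.g. T = K = ℚ, D = ℤ gives R = ℤ, which is locally weakly Krull and locally infra-Krull although D is not a field and ht(M) = 0. *)

(* Defs.v *)
From mathcomp Require Import all_boot all_order all_algebra.
From mathcomp Require Import boolp classical_sets cardinality.

Set Implicit Arguments.
Unset Strict Implicit.
Unset Printing Implicit Defensive.

Import GRing.Theory.
Local Open Scope classical_set_scope.
Local Open Scope ring_scope.

(* Integral domains are represented as subrings [S] of an ambient ring, given
   as [set]s; the predicates below are meant for [S] closed under the ring
   operations.  In this way all localizations of a domain, and their
   localizations in turn, live in the same ambient field. *)

Section Ideals.
Variable A : comNzRingType.
Implicit Types S I J P : set A.

Definition ideal S I : Prop :=
  [/\ I `<=` S, I 0,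
      forall x y, I x -> I y -> I (x + y)
    & forall a x, S a -> I x -> I (a * x)].

Definition prime_ideal S P : Prop :=
  [/\ ideal S P, P <> S
    & forall a b, S a -> S b -> P (a * b) -> P a \/ P b].

Definition maximal_ideal S I : Prop :=
  [/\ ideal S I, I <> S
    & forall J, ideal S J -> I `<=` J -> J = I \/ J = S].

Definition prime_chain S (n : nat) (c : nat -> set A) : Prop :=
  (forall i, (i <= n)%N -> prime_ideal S (c i)) /\
  (forall i, (i < n)%N -> c i `<` c i.+1).

Definition height_eq S P (n : nat) : Prop :=
  (exists2 c, prime_chain S n c & c n = P) /\
  (forall m c, prime_chain S m c -> c m = P -> (m <= n)%N).

Definition height_one_primes S : set (set A) :=
  [set P | prime_ideal S P /\ height_eq S P 1%N].

Definition lin_span S n (a : 'I_n -> A) : set A :=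
  [set x | exists r : 'I_n -> A,
     (forall i, S (r i)) /\ x = \sum_(i < n) r i * a i].

Definition noetherian S : Prop :=
  forall I, ideal S I -> exists n (a : 'I_n -> A),
    (forall i, S (a i)) /\ I = lin_span S a.

Definition bezout S : Prop :=
  forall n (a : 'I_n -> A), (forall i, S (a i)) ->
    exists2 b, S b & lin_span S a = [set r * b | r in S].

Definition finite_character (PP : set (set A)) S : Prop :=
  forall x, S x -> x <> 0 -> finite_set [set P | PP P /\ P x].

End Ideals.

Section Domains.
Variable F : fieldType.
Implicit Types S P : set F.

Definition localization S P : set F :=
  [set x | exists a s, [/\ S a, S s, ~ P s & x = a / s]].

(* The quotient field inside [F]; it may be smaller than [F]. *)
Definition quotient_field S : set F :=
  [set x | exists a s, [/\ S a, S s, s <> 0 & x = a / s]].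

Definition is_field S : Prop := forall x, S x -> x <> 0 -> S x^-1.

Definition valuation_domain S : Prop :=
  forall x, quotient_field S x -> x <> 0 -> S x \/ S x^-1.

(* The conjunct [quotient_field S x] makes the empty intersection equal to the
   quotient field of [S]. *)
Definition loc_intersection (PP : set (set F)) S : set F :=
  [set x | quotient_field S x /\ forall P, PP P -> localization S P x].

Definition weakly_krull S : Prop :=
  S = loc_intersection (height_one_primes S) S /\
  finite_character (height_one_primes S) S.

Definition infra_krull S : Prop :=
  [/\ S = loc_intersection (height_one_primes S) S,
      forall P, height_one_primes S P -> noetherian (localization S P)
    & finite_character (height_one_primes S) S].

Definition krull_type S : Prop :=
  exists PP : set (set F),
    [/\ forall P, PP P -> prime_ideal S P,
        S = loc_intersection PP S,
        forall P, PP P -> valuation_domain (localization S P)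
      & finite_character PP S].

Definition locally (X : set F -> Prop) S : Prop :=
  forall P, prime_ideal S P -> X (localization S P).

(* [F] has finite degree over its subfield [k]. *)
Definition finite_degree (k : set F) : Prop :=
  exists n (e : 'I_n -> F), lin_span k e = setT.

End Domains.

(* A subset of an integral domain [T], viewed inside the quotient field. *)
Definition in_frac (T : idomainType) (S : set T) : set {fraction T} :=
  @tofrac T @` S.

(* Main.v *)
Require Import Defs.
From mathcomp Require Import all_boot all_order all_algebra.
From mathcomp Require Import boolp classical_sets cardinality.
From mathcomp Require Import generic_quotient ring.

Set Implicit Arguments.
Unset Strict Implicit.
Unset Printing Implicit Defensive.

Import GRing.Theory.
Local Open Scope classical_set_scope.
Local Open Scope ring_scope.

(** The domains [T] and [R] and their localizations are all subrings of the
    fraction field [F] of [T]. Two observations reduce everything to local questions at [M].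

    The nonzero ideal [M] is common to [R] and [T]. For a prime [Q] of [T] not
    containing [M], the contraction [P] of [Q] to [R] satisfies [R_P = T_Q],
    since a fraction [a / s] may be multiplied above and below by an element of
    [M] outside [Q]; conversely a prime [P] of [R] not containing [M] is the
    contraction of the residual [(P : M)] ([localization_shared],
    [shared_ideal_localization]). The primes of [R] containing [M] are the
    preimages of the primes [p] of [D], and there the localization is the
    preimage [A] of [D_p] in [B = T_M] ([localization_pullback]). Hence [R] is
    locally X iff X holds for the [T_Q] with [M] not inside [Q] and for all the
    rings [A]; [T] is locally X iff X holds for the same [T_Q] and for [B].

    It remains to compare the rings [A], for varying [p], with the local ring
    [B], knowing that they share the maximal ideal [N] of [B]. When
    [A] is the intersection of its localizations at some family of primes, some
    member of the family contains [N] unless [A = B]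
    ([loc_intersection_above]), and as [D] is proper there is always a [p] with
    [A] different from [B]. Moreover a prime of [A] that is not inside [N]
    contains [N], because [N = s * N] for [s] in [A] outside [N]
    ([ideal_dominates]).

    Weakly Krull: if [A] is weakly Krull and [s] in [A] is neither in [N] nor
    invertible, [s] lies in a height-one prime, which contains [N] and so equals
    it, a contradiction. Hence [D] is a field, [N] has height one in [A], and
    so has [M] in [T]. Conversely a one-dimensional local domain is trivially
    weakly Krull.

    Infra-Krull: a one-dimensional local domain is infra-Krull iff it is
    Noetherian. If [A] is Noetherian and [n] is nonzero in [N], the ideal
    [n * B] of [A] is finitely generated, so [B] is a finite [A]-module; this
    gives Noetherianity of [B] and finiteness of [K] over [D]. Conversely a
    finite basis of [K] lifts, together with [1], to generators of [B] over [A],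
    and an ideal [I] of [A] is squeezed between a finitely generated module and
    [I * B] with a quotient of finite dimension over [D] ([span_between]).

    Krull-type: a valuation localization [A_Q] with [Q] containing [N] is
    contained in [B], whence [B] is a valuation domain and [k = K]. Only
    finitely many primes of the defining family of [A] contain [N], so by prime
    avoidance one of them is the maximal ideal if [p] is nonzero
    ([krull_type_local]); thus [A] and [D_p] are valuation domains. Conversely
    valuation domains [D_p] and [B] compose to a valuation domain [A]. *)

(** * Subrings, ideals and primes *)

Definition subring (A : comNzRingType) (S : set A) : Prop :=
  [/\ S 1, forall x y, S x -> S y -> S (x - y)
    & forall x y, S x -> S y -> S (x * y)].

Section Subrings.
Variables (A : comNzRingType) (S : set A).
Hypothesis ringS : subring S.

Lemma subring1 : S 1. Proof. by case: ringS. Qed.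
Lemma subringB x y : S x -> S y -> S (x - y).
Proof. by case: ringS => _ + _; apply. Qed.
Lemma subringM x y : S x -> S y -> S (x * y).
Proof. by case: ringS => _ _; apply. Qed.
Lemma subring0 : S 0.
Proof. by rewrite -(subrr 1); apply: subringB; exact: subring1. Qed.
Lemma subringN x : S x -> S (- x).
Proof. by move=> Sx; rewrite -sub0r; exact: subringB subring0 Sx. Qed.
Lemma subringD x y : S x -> S y -> S (x + y).
Proof.
by move=> Sx Sy; rewrite -[y]opprK; apply: subringB => //; exact: subringN.
Qed.

End Subrings.

Section PrimeIdeals.
Variables (A : comNzRingType) (S : set A).
Implicit Types P I : set A.
Hypothesis ringS : subring S.

Lemma ideal_sub I x : ideal S I -> I x -> S x.
Proof. by case=> + _ _ _; apply. Qed.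
Lemma ideal0 I : ideal S I -> I 0. Proof. by case. Qed.
Lemma idealD I x y : ideal S I -> I x -> I y -> I (x + y).
Proof. by case=> _ _ + _; apply. Qed.
Lemma idealM I a x : ideal S I -> S a -> I x -> I (a * x).
Proof. by case=> _ _ _; apply. Qed.
Lemma idealMr I a x : ideal S I -> S a -> I x -> I (x * a).
Proof. by move=> idI Sa Ix; rewrite mulrC; exact: (idealM idI). Qed.
Lemma idealB I x y : ideal S I -> I x -> I y -> I (x - y).
Proof.
move=> idI Ix Iy; apply: (idealD idI) => //; rewrite -mulN1r.
apply: (idealM idI) => //; apply: (subringN ringS); exact: subring1.
Qed.

Lemma ideal_proper I : ideal S I -> I <> S <-> ~ I 1.
Proof.
move=> idI; split=> [neqIS I1|nI1 eqIS].
  apply: neqIS; apply/seteqP; split=> x; first exact: ideal_sub.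
  by move=> Sx; rewrite -[x]mulr1; exact: (idealM idI).
by apply: nI1; rewrite eqIS; exact: subring1.
Qed.

Lemma prime_idealP P : prime_ideal S P <->
  [/\ ideal S P, ~ P 1 & forall a b, S a -> S b -> P (a * b) -> P a \/ P b].
Proof.
split=> -[idP propP primeP]; split=> //.
  by move/(ideal_proper idP): propP.
by apply/(ideal_proper idP).
Qed.

Lemma prime_ideal_ideal P : prime_ideal S P -> ideal S P. Proof. by case. Qed.
Lemma prime_not1 P : prime_ideal S P -> ~ P 1.
Proof. by case/prime_idealP. Qed.
Lemma prime_mul P a b :
  prime_ideal S P -> S a -> S b -> P (a * b) -> P a \/ P b.
Proof. by case=> _ _; apply. Qed.
Lemma prime_notM P a b :
  prime_ideal S P -> S a -> S b -> ~ P a -> ~ P b -> ~ P (a * b).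
Proof. by move=> prP Sa Sb nPa nPb /(prime_mul prP Sa Sb)[]. Qed.

End PrimeIdeals.

Lemma prime_ideal_contract (A : comNzRingType) (S S' P : set A) :
  subring S -> S `<=` S' -> subring S' -> prime_ideal S' P ->
  prime_ideal S (P `&` S).
Proof.
move=> ringS sSS' ringS' prP; have idP := prime_ideal_ideal prP.
apply/(prime_idealP ringS); split.
- split=> [x []//||x y [Px Sx] [Py Sy]|a x Sa [Px Sx]].
  + by split; [exact: ideal0 idP | exact: subring0].
  + by split; [exact: idealD idP _ _ | exact: subringD].
  + by split; [apply: idealM idP _ _ => //; exact: sSS' | exact: subringM].
- by case=> /(prime_not1 ringS' prP).
- move=> a b Sa Sb [Pab _].
  by have [] := prime_mul prP (sSS' _ Sa) (sSS' _ Sb) Pab; [left|right].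
Qed.

(** * Height one *)

(** Height one without chains: the form in which it moves between rings whose
    primes are in correspondence. *)
Definition minimal_nonzero_prime (A : comNzRingType) (S P : set A) : Prop :=
  [/\ prime_ideal S P, exists2 x, P x & x != 0
    & forall Q, prime_ideal S Q -> Q `<=` P -> Q `<=` [set 0] \/ P `<=` Q].

Lemma prime_ideal_zero (A : idomainType) (S : set A) :
  subring S -> prime_ideal S [set 0].
Proof.
move=> ringS; apply/prime_idealP => //; split.
- split=> [x ->|//|x y -> ->|a x _ ->]; rewrite ?addr0 ?mulr0 //.
  exact: subring0.
- by move=> /eqP; rewrite oner_eq0.
- by move=> a b _ _ /eqP; rewrite mulf_eq0 => /orP[]/eqP; [left|right].
Qed.

(** A chain of length two below [P] amounts to a nonzero prime strictly inside
    [P], because the zero ideal is prime. *)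
Lemma height_eq1P (A : idomainType) (S P : set A) : subring S ->
  height_eq S P 1%N <-> minimal_nonzero_prime S P.
Proof.
move=> ringS; have pr0 := prime_ideal_zero ringS; split.
  move=> [[c [prc ltc] c1P] maxP].
  have prP : prime_ideal S P by rewrite -c1P; exact: prc.
  have [_ /existsNP[x /not_implyP[Px ncx]]] := ltc 0%N isT.
  split=> //.
    exists x; first by rewrite -c1P.
    by apply/eqP => x0; apply: ncx; rewrite x0; case: (prc 0%N isT) => -[].
  move=> Q prQ sQP; apply: contrapT => /not_orP[nQ0 nPQ].
  pose e i := if i is i'.+1 then if i' is 0%N then Q else P else [set (0 : A)].
  suff: (2 <= 1)%N by [].
  apply: (maxP 2%N e) => //; split=> -[|[|[|]]]//= _.
  by split=> // x' ->; case: prQ => -[].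
move=> [prP [x Px x0] minP]; split.
  exists (fun i => if i is 0%N then [set 0] else P) => //.
  split=> -[|[|]]//= _; split=> [y ->|/(_ _ Px)/eqP]; last by rewrite (negPf x0).
  by case: prP => -[].
move=> [|[|m]] // c [prc ltc] cmP.
have [ltP nPle] := ltc m.+1 (leqnn _).
have [lt0 /existsNP[y /not_implyP[cy ncy]]] := ltc m (leqnSn _).
rewrite cmP in ltP nPle; have [//||//] := minP (c m.+1) _ ltP.
  exact/prc/leqnSn.
move=> /(_ _ cy) y0; case: ncy; rewrite y0.
by case: (prc m (ltnW (leqnSn _))) => -[].
Qed.

Lemma height_one_primesP (A : idomainType) (S P : set A) : subring S ->
  height_one_primes S P <-> minimal_nonzero_prime S P.
Proof.
move=> ringS; split=> [[_ /(height_eq1P _ ringS)//]|hP].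
by split; [case: hP | exact/height_eq1P].
Qed.

(** * Localization inside the quotient field *)

(** The extension of the ideal [I] to the localization at [P]; for [I = S] this
    is [localization S P] itself. *)
Definition ext_ideal (F : fieldType) (S P I : set F) : set F :=
  [set x | exists a s, [/\ I a, S s, ~ P s & x = a / s]].

Definition local_domain (F : fieldType) (S N : set F) : Prop :=
  prime_ideal S N /\ forall x, S x -> ~ N x -> S x^-1.

Section Localization.
Variables (F : fieldType) (S P : set F).
Hypotheses (ringS : subring S) (prP : prime_ideal S P).
Implicit Types I Q : set F.

Let notP_neq0 s : ~ P s -> s != 0.
Proof. by move=> nPs; apply/eqP => s0; apply: nPs; rewrite s0; case: prP => -[]. Qed.

Lemma sub_localization : S `<=` localization S P.
Proof.
move=> x Sx; exists x, 1; split=> //; last by rewrite divr1.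
  exact: subring1.
exact: (prime_not1 ringS prP).
Qed.

Lemma localizationV s : S s -> ~ P s -> localization S P s^-1.
Proof. by move=> Ss nPs; exists 1, s; rewrite mul1r; split=> //; exact: subring1. Qed.

Lemma localization_subring : subring (localization S P).
Proof.
split; first by apply: sub_localization; exact: subring1.
  move=> _ _ [a [s [Sa Ss nPs ->]]] [b [t [Sb St nPt ->]]].
  exists (a * t - b * s), (s * t); split.
  - by apply: (subringB ringS); apply: (subringM ringS).
  - exact: subringM.
  - exact: (prime_notM prP).
  - by field; rewrite !notP_neq0.
move=> _ _ [a [s [Sa Ss nPs ->]]] [b [t [Sb St nPt ->]]].
exists (a * b), (s * t); split; try exact: subringM.
  exact: (prime_notM prP).
by rewrite invfM mulrACA.
Qed.

Lemma sub_ext_ideal I : I `<=` ext_ideal S P I.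
Proof.
move=> x Ix; exists x, 1; split=> //; last by rewrite divr1.
  exact: subring1.
exact: (prime_not1 ringS prP).
Qed.

Lemma ext_ideal_contract Q x :
  prime_ideal S Q -> Q `<=` P -> S x -> ext_ideal S P Q x -> Q x.
Proof.
move=> prQ sQP Sx [a [s [Qa Ss nPs xE]]].
have : Q (x * s) by rewrite xE divfK // notP_neq0.
by case/(prime_mul prQ Sx Ss) => // /sQP.
Qed.

Lemma ext_ideal_prime Q :
  prime_ideal S Q -> Q `<=` P -> prime_ideal (localization S P) (ext_ideal S P Q).
Proof.
move=> prQ sQP; have idQ := prime_ideal_ideal prQ.
apply/(prime_idealP localization_subring); split.
- split.
  + by move=> _ [a [s [Qa Ss nPs ->]]]; exists a, s; split=> //; exact: ideal_sub idQ _.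
  + by apply: sub_ext_ideal; exact: ideal0 idQ.
  + move=> _ _ [a [s [Qa Ss nPs ->]]] [b [t [Qb St nPt ->]]].
    exists (a * t + b * s), (s * t); split.
    * by apply: (idealD idQ); apply: (idealMr idQ).
    * exact: subringM.
    * exact: (prime_notM prP).
    * by field; rewrite !notP_neq0.
  + move=> _ _ [b [t [Sb St nPt ->]]] [a [s [Qa Ss nPs ->]]].
    exists (b * a), (t * s); split.
    * exact: (idealM idQ).
    * exact: subringM.
    * exact: (prime_notM prP).
    * by rewrite invfM mulrACA.
- move/(ext_ideal_contract prQ sQP (subring1 ringS)); exact: (prime_not1 ringS).
- move=> _ _ [a [s [Sa Ss nPs ->]]] [b [t [Sb St nPt ->]]].
  move=> [c [u [Qc Su nPu abE]]].
  have : Q ((a * b) * u).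
    have -> : a * b * u = c * (s * t).
      have [s0 t0 u0] := And3 (notP_neq0 nPs) (notP_neq0 nPt) (notP_neq0 nPu).
      have -> : a * b = (a / s) * (b / t) * (s * t) by field; rewrite s0 t0.
      by rewrite abE; field.
    by apply: (idealMr idQ) => //; exact: subringM.
  case/(prime_mul prQ (subringM ringS Sa Sb) Su) => [|/sQP//].
  by case/(prime_mul prQ Sa Sb); [left; exists a, s | right; exists b, t].
Qed.

Lemma localization_local : local_domain (localization S P) (ext_ideal S P P).
Proof.
split; first exact: ext_ideal_prime.
move=> _ [a [s [Sa Ss nPs ->]]] nPas; rewrite invf_div; exists s, a; split=> //.
by move=> Pa; apply: nPas; exists a, s.
Qed.

(** Primes of the localization are extended from their contractions. *)
Lemma ext_ideal_of_contract Q :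
  prime_ideal (localization S P) Q -> Q `<=` ext_ideal S P (Q `&` S).
Proof.
move=> prQ x Qx; have [a [s [Sa Ss nPs xE]]] := ideal_sub (prime_ideal_ideal prQ) Qx.
exists a, s; split=> //; split=> //.
have -> : a = x * s by rewrite xE divfK // notP_neq0.
by apply: (idealMr (prime_ideal_ideal prQ)) => //; exact: sub_localization.
Qed.

Lemma minimal_nonzero_prime_localization :
  minimal_nonzero_prime S P <->
  minimal_nonzero_prime (localization S P) (ext_ideal S P P).
Proof.
split=> -[_ [p Pp p0] minP]; split=> //.
- exact: ext_ideal_prime.
- by exists p => //; exact: sub_ext_ideal.
- move=> Q prQ sQP.
  have prQS := prime_ideal_contract ringS sub_localization localization_subring prQ.
  case: (minP _ prQS) => [x [Qx Sx]|Q0|sPQ].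
  + by apply: (ext_ideal_contract prP _ Sx) => //; exact: sQP.
  + left=> x /(ext_ideal_of_contract prQ)[a [s [/Q0 -> _ _ ->]]].
    by rewrite mul0r.
  + right=> x [a [s [/sPQ[Qa _] Ss nPs ->]]].
    by apply: (idealMr (prime_ideal_ideal prQ)) => //; exact: localizationV.
- have [a [s [Pa Ss nPs pE]]] := Pp; exists a => //.
  by apply: contraNneq p0 => a0; rewrite pE a0 mul0r.
- move=> Q prQ sQP; case: (minP _ (ext_ideal_prime prQ sQP)).
  + by move=> _ [a [s [Qa Ss nPs ->]]]; exists a, s; split=> //; exact: sQP.
  + by move=> Q0; left=> x Qx; apply: Q0; exact: sub_ext_ideal.
  + move=> sPQ; right=> x Px; apply: (ext_ideal_contract prQ sQP).
      exact: ideal_sub (prime_ideal_ideal prP) Px.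
    by apply: sPQ; exact: sub_ext_ideal.
Qed.

End Localization.

Section LocalDomains.
Variables (F : fieldType) (S N : set F).
Hypotheses (ringS : subring S) (locS : local_domain S N).

Lemma localization_at_maximal : localization S N = S.
Proof.
case: locS => prN unitS; apply/seteqP; split; last exact: sub_localization.
by move=> _ [a [s [Sa Ss nNs ->]]]; apply: subringM => //; exact: unitS.
Qed.

Lemma prime_sub_maximal Q : prime_ideal S Q -> Q `<=` N.
Proof.
move=> prQ x Qx; apply: contrapT => nNx.
have Sx := ideal_sub (prime_ideal_ideal prQ) Qx.
apply: (prime_not1 ringS prQ); rewrite -(mulVf (x := x)).
  by apply: idealM (prime_ideal_ideal prQ) _ _ => //; exact: locS.2.
by apply/eqP => x0; apply: nNx; rewrite x0; case: locS => -[[]].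
Qed.

Lemma loc_intersection_maximal (PP : set (set F)) :
  PP N -> (forall Q, PP Q -> prime_ideal S Q) -> S = loc_intersection PP S.
Proof.
move=> PPN prPP; apply/seteqP; split=> [x Sx|x [_ /(_ _ PPN)]].
  split; last by move=> Q /prPP prQ; exact: sub_localization.
  exists x, 1; rewrite divr1; split=> //; first exact: subring1.
  by apply/eqP; rewrite oner_eq0.
by rewrite localization_at_maximal.
Qed.

Lemma finite_character_set1 : finite_character [set N] S.
Proof.
move=> x _ _; apply: (sub_finite_set _ (finite_set1 N)).
by move=> P /= [].
Qed.

Section HeightOne.
Hypothesis htN : minimal_nonzero_prime S N.

Lemma height_one_primes_local : height_one_primes S = [set N].
Proof.
apply/seteqP; split=> [P /(height_one_primesP _ ringS)[prP [x Px x0] _]|_ ->].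
  have sPN := prime_sub_maximal prP; case: htN => _ _ minN.
  have [/(_ _ Px)/eqP|sNP] := minN _ prP sPN; first by rewrite (negPf x0).
  by apply/seteqP.
exact/height_one_primesP.
Qed.

(** In dimension one the only localization at a height-one prime is [S]
    itself. *)
Lemma weakly_krull_local : weakly_krull S.
Proof.
rewrite /weakly_krull height_one_primes_local; split.
  by apply: loc_intersection_maximal => // Q ->; case: locS.
exact: finite_character_set1.
Qed.

Lemma infra_krull_local : infra_krull S <-> noetherian S.
Proof.
have [wk1 wk2] := weakly_krull_local; split.
  case=> _ + _; rewrite height_one_primes_local => /(_ N erefl).
  by rewrite localization_at_maximal.
move=> noethS; split=> // P; rewrite height_one_primes_local => ->.
by rewrite localization_at_maximal.
Qed.

End HeightOne.

Lemma krull_type_local_valuation : valuation_domain S -> krull_type S.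
Proof.
move=> valS; exists [set N]; split.
- by move=> _ ->; case: locS.
- by apply: loc_intersection_maximal => // Q ->; case: locS.
- by move=> _ ->; rewrite localization_at_maximal.
- exact: finite_character_set1.
Qed.

End LocalDomains.

(** * Two domains sharing an ideal *)

Section SharedIdeal.
Variables (F : fieldType) (A B N : set F).
Hypotheses (ringA : subring A) (ringB : subring B) (sAB : A `<=` B).
Hypotheses (idN : ideal B N) (sNA : N `<=` A).
Implicit Types P Q : set F.

(** The residual quotient [(P : N)] in [B]. *)
Definition residual P : set F := [set b | B b /\ forall n, N n -> P (b * n)].

Lemma residual_contract P :
  prime_ideal A P -> ~ N `<=` P -> residual P `&` A = P.
Proof.
move=> prP /existsNP[n /not_implyP[Nn nPn]]; have idP := prime_ideal_ideal prP.
apply/seteqP; split=> [a [[_ /(_ n Nn)]]|a Pa].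
  by move=> Pan Aa; case: (prime_mul prP Aa (sNA Nn) Pan).
have Aa := ideal_sub idP Pa; split=> //; split; first exact: sAB.
by move=> m /sNA Am; exact: (idealMr idP).
Qed.

Lemma residual_prime P :
  prime_ideal A P -> ~ N `<=` P -> prime_ideal B (residual P).
Proof.
move=> prP nNP; have idP := prime_ideal_ideal prP.
have /existsNP[n /not_implyP[Nn nPn]] := nNP.
apply/(prime_idealP ringB); split.
- split.
  + by move=> b [].
  + split; first exact: subring0.
    by move=> m _; rewrite mul0r; exact: ideal0 idP.
  + move=> b c [Bb Pb] [Bc Pc]; split; first exact: subringD.
    by move=> m Nm; rewrite mulrDl; apply: (idealD idP); [exact: Pb | exact: Pc].
  + move=> a b Ba [Bb Pb]; split; first exact: subringM.
    by move=> m Nm; rewrite mulrAC mulrC; apply: Pb; exact: (idealM idN).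
- by case=> _ /(_ n Nn); rewrite mul1r.
- move=> a b Ba Bb [_ Pab]; apply: contrapT => /not_orP[na nb].
  have [x Nx nPax] : exists2 x, N x & ~ P (a * x).
    by apply: contrapT => h; apply: na; split=> // m Nm; apply: contrapT => ?; apply: h; exists m.
  have [y Ny nPby] : exists2 x, N x & ~ P (b * x).
    by apply: contrapT => h; apply: nb; split=> // m Nm; apply: contrapT => ?; apply: h; exists m.
  have : P (a * x * (b * y)).
    by rewrite mulrACA; apply: Pab; apply: (idealM idN) => //; exact/sAB/sNA.
  by case/(prime_mul prP); try (by apply: sNA; apply: (idealM idN)).
Qed.

(** [a / s = (a * n) / (s * n)] for [n] in [N] outside [Q]. *)
Lemma localization_shared Q : prime_ideal B Q -> ~ N `<=` Q ->
  localization A (Q `&` A) = localization B Q.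
Proof.
move=> prQ /existsNP[n /not_implyP[Nn nQn]]; have Bn := sAB (sNA Nn).
apply/seteqP; split=> _ [a [s [Ba Bs nQs ->]]].
  by exists a, s; split=> //; [exact: sAB | exact: sAB | move=> Qs; apply: nQs].
exists (a * n), (s * n); split.
- by apply: sNA; exact: (idealM idN).
- by apply: sNA; exact: (idealM idN).
- by case=> + _; exact: (prime_notM prQ).
- by rewrite -mulf_div divff ?mulr1 //; apply/eqP => n0; apply: nQn; rewrite n0; case: prQ => -[].
Qed.

Lemma shared_ideal_localization P : prime_ideal A P -> ~ N `<=` P ->
  exists Q, [/\ prime_ideal B Q, ~ N `<=` Q & localization A P = localization B Q].
Proof.
move=> prP nNP; have prQ := residual_prime prP nNP.
have resP := residual_contract prP nNP.
have nNQ : ~ N `<=` residual P.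
  by move=> sNQ; apply: nNP => n Nn; rewrite -resP; split; [exact: sNQ | exact: sNA].
by exists (residual P); split=> //; rewrite -(localization_shared prQ nNQ) resP.
Qed.

(** If none of the primes defining [A] contains [N] then every localization
    absorbs [B], since [b = (b * n) / n]. *)
Lemma shared_ideal_loc_intersection (PP : set (set F)) :
  (exists2 n, N n & n != 0) -> A = loc_intersection PP A ->
  (forall P, PP P -> prime_ideal A P) -> (forall P, PP P -> ~ N `<=` P) ->
  A = B.
Proof.
move=> [n Nn n0] AE prPP nPP; apply/seteqP; split=> // b Bb.
have fracb m : m != 0 -> b = b * m / m by move=> ?; rewrite mulfK.
rewrite AE; split.
  exists (b * n), n; split; [|exact: sNA|exact/eqP|exact: fracb].
  by apply: sNA; exact: (idealM idN).
move=> P PPP; have /existsNP[m /not_implyP[Nm nPm]] := nPP _ PPP.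
exists (b * m), m; split=> //; [|exact: sNA|].
  by apply: sNA; exact: (idealM idN).
apply: fracb; apply/eqP => m0; apply: nPm; rewrite m0.
exact: ideal0 (prime_ideal_ideal (prPP _ PPP)).
Qed.

Hypothesis maxN : forall t, B t -> ~ N t -> exists2 u, B u & N (1 - t * u).
Hypothesis properN : ~ N 1.
Hypothesis nzN : exists2 n, N n & n != 0.

(** Below [N] the primes other than [N] correspond, by residual and
    contraction. *)
Lemma minimal_nonzero_prime_shared : prime_ideal A N -> prime_ideal B N ->
  minimal_nonzero_prime B N <-> minimal_nonzero_prime A N.
Proof.
move=> prAN prBN; split=> -[_ _ minN]; split=> // P prP sPN.
  have [sNP|nNP] := pselect (N `<=` P); first by right.
  have prQ := residual_prime prP nNP; have resP := residual_contract prP nNP.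
  have idQ := prime_ideal_ideal prQ.
  case: (minN _ prQ).
  - move=> t Qt; have Bt := ideal_sub idQ Qt; apply: contrapT => nNt.
    have [u Bu Ntu] := maxN Bt nNt.
    have Atu : A (t * u).
      rewrite -[t * u](subKr 1); apply: (subringB ringA); first exact: subring1.
      exact: sNA.
    have /sPN Ntu' : P (t * u) by rewrite -resP; split=> //; exact: (idealMr idQ).
    by apply: properN; rewrite -(subrK (t * u) 1); exact: (idealD idN).
  - by move=> Q0; left=> x; rewrite -{1}resP => -[/Q0].
  - by move=> sNQ; right=> x Nx; rewrite -resP; split; [exact: sNQ | exact: sNA].
case: (minN _ (prime_ideal_contract ringA sAB ringB prP)).
- by move=> x [/sPN].
- move=> PA0; left=> x Px; have [n Nn n0] := nzN.
  have : (P `&` A) (x * n).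
    have Bx := ideal_sub (prime_ideal_ideal prP) Px.
    split; first by apply: (idealMr (prime_ideal_ideal prP)) => //; exact/sAB/sNA.
    by apply: sNA; exact: (idealM idN).
  by move/PA0/eqP; rewrite mulf_eq0 (negPf n0) orbF => /eqP.
- by move=> sNP; right=> x /sNP[].
Qed.

End SharedIdeal.

(** * Prime avoidance and existence of primes *)

Section PrimeAvoidance.
Variables (A : comNzRingType) (S : set A).
Hypothesis ringS : subring S.
Implicit Types (P Q I : set A) (s : seq (set A)).

(* Those ideals of the list that are not inside [Q] have a common element
   outside [Q], namely a product. *)
Let separator Q s : prime_ideal S Q -> (forall P, P \in s -> ideal S P) ->
  exists w, [/\ S w, ~ Q w & forall P, P \in s -> P `<=` Q \/ P w].
Proof.
move=> prQ; elim: s => [|P s IH] ids.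
  by exists 1; split=> //; [exact: subring1 | exact: (prime_not1 ringS)].
have [|w [Sw nQw ws]] := IH; first by move=> ? Ps; apply: ids; rewrite inE Ps orbT.
have idP : ideal S P by apply: ids; rewrite mem_head.
have [sPQ|/existsNP[v /not_implyP[Pv nQv]]] := pselect (P `<=` Q).
  by exists w; split=> // P'; rewrite inE => /predU1P[->|/ws]; [left|].
have Sv := ideal_sub idP Pv.
exists (w * v); split; [exact: subringM|exact: (prime_notM prQ)|].
move=> P'; rewrite inE => /predU1P[->|P's]; first by right; exact: (idealM idP).
have [|P'w] := ws _ P's; [by left | right; apply: (idealMr _ Sv P'w)].
by apply: ids; rewrite inE P's orbT.
Qed.

Lemma prime_avoidance I s : ideal S I ->
  (forall P, P \in s -> prime_ideal S P /\ ~ I `<=` P) ->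
  exists2 x, I x & forall P, P \in s -> ~ P x.
Proof.
move=> idI; elim: s => [|Q s IH] hs; first by exists 0 => //; exact: ideal0 idI.
have [|x Ix xs] := IH; first by move=> P Ps; apply: hs; rewrite inE Ps orbT.
have [prQ nIQ] : prime_ideal S Q /\ ~ I `<=` Q by apply: hs; rewrite mem_head.
have [Qx|nQx] := pselect (Q x); last first.
  by exists x => // P; rewrite inE => /predU1P[->|/xs].
have /existsNP[z /not_implyP[Iz nQz]] := nIQ.
have ids P : P \in s -> ideal S P.
  by move=> Ps; case: (hs P); [rewrite inE Ps orbT | case].
have [w [Sw nQw ws]] := separator prQ ids.
have nQzw : ~ Q (z * w) by apply: (prime_notM prQ) => //; exact: ideal_sub idI Iz.
(* [z * w] moves [x] out of [Q]; it lies in every other prime of the list except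
   those inside [Q], which [x + z * w] avoids along with [Q]. *)
have nQy : ~ Q (x + z * w).
  move=> Qy; apply: nQzw; rewrite -(addKr x (z * w)) addrC.
  exact: (idealB ringS (prime_ideal_ideal prQ)).
exists (x + z * w); first by apply: (idealD idI) => //; exact: (idealMr idI).
move=> P; rewrite inE => /predU1P[->//|Ps] Py.
have [/(_ _ Py)//|Pw] := ws _ Ps.
apply: (xs _ Ps); rewrite -(addrK (z * w) x); apply: (idealB ringS (ids _ Ps)) => //.
by apply: (idealM (ids _ Ps)) => //; exact: ideal_sub idI Iz.
Qed.

End PrimeAvoidance.

Section PrimeExistence.
Variables (A : comNzRingType) (S : set A) (s : A).
Hypothesis ringS : subring S.

(** An ideal maximal among those that contain [s] and avoid [1] is prime. The
    empty set is admitted in the Zorn argument as the union of the empty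
    chain. *)
Lemma prime_ideal_exists : S s -> (forall r, S r -> s * r <> 1) ->
  exists2 P, prime_ideal S P & P s.
Proof.
move=> Ss nunit.
pose good (I : set A) := I = set0 \/ [/\ ideal S I, I s & ~ I 1].
have goodP I x : good I -> I x -> [/\ ideal S I, I s & ~ I 1].
  by move=> [->|].
have [|J [goodJ maxJ]] := @Zorn_bigcup _ good.
  move=> C goodC totC.
  have [->|/set0P[x0 [I0 CI0 I0x0]]] := eqVneq (\bigcup_(X in C) X) set0; first by left.
  have [idI0 I0s _] := goodP _ _ (goodC _ CI0) I0x0.
  right; split; last 2 first.
  - by exists I0.
  - by move=> [I CI I1]; have [_ _] := goodP _ _ (goodC _ CI) I1.
  split.
  - by move=> x [I CI Ix]; have [idI _ _] := goodP _ _ (goodC _ CI) Ix; exact: ideal_sub idI Ix.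
  - by exists I0 => //; exact: ideal0 idI0.
  - move=> x y [I CI Ix] [I' CI' I'y].
    have [idI _ _] := goodP _ _ (goodC _ CI) Ix.
    have [idI' _ _] := goodP _ _ (goodC _ CI') I'y.
    have [sII'|sI'I] := totC _ _ CI CI'.
      by exists I' => //; apply: (idealD idI') => //; exact: sII'.
    by exists I => //; apply: (idealD idI) => //; exact: sI'I.
  - move=> a x Sa [I CI Ix]; have [idI _ _] := goodP _ _ (goodC _ CI) Ix.
    by exists I => //; exact: (idealM idI).
have [idJ Js nJ1] : [/\ ideal S J, J s & ~ J 1].
  case: goodJ => // J0.
  have multiples_ideal : ideal S [set y | exists2 r, S r & y = s * r].
    split.
    - by move=> _ [r Sr ->]; exact: subringM.
    - by exists 0; rewrite ?mulr0 //; exact: subring0.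
    - move=> _ _ [r Sr ->] [r' Sr' ->]; exists (r + r'); rewrite ?mulrDr //.
      exact: subringD.
    - by move=> a _ Sa [r Sr ->]; exists (a * r); rewrite ?(mulrCA a) //; exact: subringM.
  have ss : [set y | exists2 r, S r & y = s * r] s.
    by exists 1; rewrite ?mulr1 //; exact: subring1.
  case: (maxJ _ _ (or_intror (And3 multiples_ideal ss _))).
    by rewrite J0; split=> // /(_ s ss).
  by move=> [r /nunit + /esym].
have enlarge a : S a -> ~ J a -> exists m r, [/\ J m, S r & 1 = m + a * r].
  move=> Sa nJa; pose J' := [set y | exists m r, [/\ J m, S r & y = m + a * r]].
  have sJJ' : J `<=` J'.
    by move=> m Jm; exists m, 0; rewrite mulr0 addr0; split=> //; exact: subring0.
  have J'a : J' a.
    by exists 0, 1; rewrite add0r mulr1; split; [exact: ideal0 idJ| exact: subring1 |].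
  apply: contrapT => nJ'1; apply: (maxJ J').
    by split=> // /(_ _ J'a).
  right; split=> //; last exact: sJJ'.
  split.
  - move=> _ [m [r [Jm Sr ->]]]; apply: (subringD ringS) (ideal_sub idJ Jm) _.
    exact: subringM.
  - exact/sJJ'/(ideal0 idJ).
  - move=> _ _ [m [r [Jm Sr ->]]] [m' [r' [Jm' Sr' ->]]].
    exists (m + m'), (r + r'); rewrite mulrDr addrACA.
    by split=> //; [exact: (idealD idJ) | exact: subringD].
  - move=> b _ Sb [m [r [Jm Sr ->]]]; exists (b * m), (b * r).
    by rewrite mulrDr (mulrCA b); split=> //; [exact: (idealM idJ) | exact: subringM].
exists J => //; apply/(prime_idealP ringS); split=> // a b Sa Sb Jab.
apply: contrapT => /not_orP[nJa nJb]; apply: nJ1.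
have [m [r [Jm Sr E]]] := enlarge a Sa nJa.
have [m' [r' [Jm' Sr' E']]] := enlarge b Sb nJb.
have -> : 1 = m + (a * r) * m' + (r * r') * (a * b).
  by rewrite {1}E -{1}[a * r]mulr1 {1}E'; ring.
apply: (idealD idJ); last by apply: (idealM idJ) => //; exact: subringM.
by apply: (idealD idJ) => //; apply: (idealM idJ) => //; exact: subringM.
Qed.

End PrimeExistence.

(** * Finitely generated modules *)

Section Spans.
Variable F : fieldType.
Implicit Types (S I : set F) (s t : seq F).

Fixpoint span S s : set F :=
  if s is x :: s' then [set y | exists a z, [/\ S a, span S s' z & y = a * x + z]]
  else [set 0].

Lemma span0 S s : subring S -> span S s 0.
Proof.
move=> ringS; elim: s => [|x s IH] //=; exists 0, 0.
by rewrite mul0r addr0; split=> //; exact: subring0.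
Qed.

Lemma spanD S s x y : subring S -> span S s x -> span S s y -> span S s (x + y).
Proof.
move=> ringS; elim: s x y => [|z s IH] x y /=; first by move=> -> ->; rewrite addr0.
move=> [a [u [Sa su ->]]] [b [v [Sb sv ->]]]; exists (a + b), (u + v).
by rewrite mulrDl addrACA; split=> //; [exact: subringD | exact: IH].
Qed.

Lemma spanM S s c x : subring S -> S c -> span S s x -> span S s (c * x).
Proof.
move=> ringS Sc; elim: s x => [|z s IH] x /=; first by move=> ->; rewrite mulr0.
move=> [a [u [Sa su ->]]]; exists (c * a), (c * u).
by rewrite mulrDr mulrA; split=> //; [exact: subringM | exact: IH].
Qed.

Lemma mem_span S s x : subring S -> x \in s -> span S s x.
Proof.
move=> ringS; elim: s => [|y s IH] //=; rewrite inE => /predU1P[->|/IH sx].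
  exists 1, 0; rewrite mul1r addr0; split=> //; first exact: subring1.
  exact: span0.
by exists 0, x; rewrite mul0r add0r; split=> //; exact: subring0.
Qed.

Lemma span_min S s (W : set F) : W 0 -> (forall x y, W x -> W y -> W (x + y)) ->
  (forall a x, S a -> W x -> W (a * x)) -> (forall x, x \in s -> W x) ->
  span S s `<=` W.
Proof.
move=> W0 WD WM; elim: s => [|x s IH] sW y /=; first by move=> ->.
move=> [a [z [Sa sz ->]]]; apply: WD.
  by apply: WM => //; apply: sW; exact: mem_head.
by apply: IH sz => w ws; apply: sW; rewrite inE ws orbT.
Qed.

Lemma span_sub_ideal S s I :
  ideal S I -> (forall x, x \in s -> I x) -> span S s `<=` I.
Proof. by case=> _ I0 ID IM; exact: span_min. Qed.

Lemma span_sub_span S s t : subring S ->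
  (forall x, x \in s -> span S t x) -> span S s `<=` span S t.
Proof.
move=> ringS; apply: span_min; [exact: span0 | | ].
  by move=> *; exact: spanD.
by move=> *; exact: spanM.
Qed.

Lemma span_scalars S S' s : S `<=` S' -> span S s `<=` span S' s.
Proof.
move=> sSS'; elim: s => [|x s IH] y //= [a [z [Sa sz ->]]].
by exists a, z; split=> //; [exact: sSS' | exact: IH].
Qed.

Lemma span_map_mul S s c x :
  span S s x -> span S [seq c * y | y <- s] (c * x).
Proof.
elim: s x => [|y s IH] x /=; first by move=> ->; rewrite mulr0.
by move=> [a [z [Sa /IH sz ->]]]; exists a, (c * z); rewrite mulrDr mulrCA.
Qed.

Lemma lin_span_span S n (a : 'I_n -> F) : subring S ->
  lin_span S a = span S [seq a i | i <- enum 'I_n].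
Proof.
move=> ringS; apply/seteqP; split=> [_ [r [Sr ->]]|].
  apply: (big_ind (span S _)); [exact: span0 | by move=> *; exact: spanD |].
  move=> i _; apply: spanM => //; apply: mem_span => //.
  by apply: map_f; rewrite mem_enum.
apply: span_min.
- exists (fun=> 0); split=> [_|]; first exact: subring0.
  by rewrite big1 // => i _; rewrite mul0r.
- move=> _ _ [r [Sr ->]] [r' [Sr' ->]]; exists (fun i => r i + r' i).
  split=> [i|]; first exact: subringD.
  by rewrite -big_split; apply: eq_bigr => i _; rewrite mulrDl.
- move=> c _ Sc [r [Sr ->]]; exists (fun i => c * r i).
  split=> [i|]; first exact: subringM.
  by rewrite mulr_sumr; apply: eq_bigr => i _; rewrite mulrA.
- move=> _ /mapP[i _ ->]; exists (fun j => (j == i)%:R); split.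
    by move=> j; case: eqP => _; [exact: subring1 | exact: subring0].
  rewrite (bigD1 i) //= eqxx mul1r big1 ?addr0 // => j /negPf ->.
  by rewrite mul0r.
Qed.

Lemma span_lin_span S s : subring S ->
  span S s = lin_span S (fun i : 'I_(size s) => s`_i).
Proof.
move=> ringS; rewrite lin_span_span //; congr (span S _).
rewrite -[LHS](mkseq_nth 0) /mkseq -val_enum_ord -map_comp.
by apply: eq_map.
Qed.

Lemma noetherianP S : subring S ->
  noetherian S <-> forall I, ideal S I -> exists s, I = span S s.
Proof.
move=> ringS; split=> h I idI.
  by have [n [a [_ ->]]] := h I idI; eexists; exact: lin_span_span.
have [s IE] := h I idI.
exists (size s), (fun i : 'I_(size s) => s`_i); rewrite -span_lin_span //.
split=> // i; apply: (ideal_sub idI); rewrite IE; apply: mem_span => //.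
exact: mem_nth.
Qed.

End Spans.

Section NoetherianTransfer.
Variables (F : fieldType) (A B : set F).
Hypotheses (ringA : subring A) (ringB : subring B) (sAB : A `<=` B).
Implicit Types I : set F.

(** Multiplication by [n] embeds every ideal of [B] into [A] as an ideal. *)
Lemma ideal_span_noetherian n I : n != 0 -> (forall b, B b -> A (n * b)) ->
  noetherian A -> ideal B I -> exists s, I = span A s.
Proof.
move=> n0 nBA /(noetherianP ringA) noethA idI.
have idnI : ideal A [set y | exists2 x, I x & y = n * x].
  split.
  - by move=> _ [x /(ideal_sub idI) /nBA + ->].
  - by exists 0; rewrite ?mulr0 //; exact: ideal0 idI.
  - by move=> _ _ [x Ix ->] [y Iy ->]; exists (x + y); rewrite ?mulrDr //; exact: (idealD idI).
  - by move=> a _ /sAB Ba [x Ix ->]; exists (a * x); rewrite 1?mulrCA //; exact: (idealM idI).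
have [s nIE] := noethA _ idnI; exists [seq n^-1 * y | y <- s].
apply/seteqP; split=> [x Ix|].
  rewrite -[x](mulKf n0); apply: span_map_mul; rewrite -nIE; by exists x.
apply: span_min; [exact: ideal0 idI | by move=> *; exact: (idealD idI) | |].
  by move=> a x /sAB; exact: (idealM idI).
move=> _ /mapP[y ys ->].
have : [set y | exists2 x, I x & y = n * x] y by rewrite nIE; exact: mem_span.
by move=> [x Ix ->]; rewrite mulKf.
Qed.

Lemma noetherian_overring n : n != 0 -> (forall b, B b -> A (n * b)) ->
  noetherian A -> noetherian B.
Proof.
move=> n0 nBA noethA; apply/(noetherianP ringB) => I idI.
have [s IE] := ideal_span_noetherian n0 nBA noethA idI.
exists s; apply/seteqP; split; first by rewrite IE; exact: span_scalars.
by apply: (span_sub_ideal idI) => x xs; rewrite IE; exact: mem_span.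
Qed.

Lemma span_tower bs xs :
  B = span A bs -> span B xs `<=` span A [seq b * x | b <- bs, x <- xs].
Proof.
move=> BE; elim: xs => [|x xs IH] y.
  by move=> ->; exact: span0.
move=> [b [z [Bb /IH xsz ->]]]; apply: spanD => //; last first.
  apply: span_sub_span xsz => // _ /allpairsP[[c u] [cbs uxs ->]].
  apply: (mem_span ringA); apply: (allpairs_f (fun b x => b * x)) => //.
  by rewrite inE uxs orbT.
rewrite mulrC; move: Bb; rewrite {1}BE => /(span_map_mul x).
apply: span_sub_span => // _ /mapP[c cbs ->]; apply: (mem_span ringA).
by rewrite mulrC; apply: (allpairs_f (fun b x => b * x)) (mem_head _ _).
Qed.

Section Descent.
Variable N : set F.
Hypotheses (idN : ideal B N) (sNA : N `<=` A).
Hypothesis unitA : forall a, A a -> ~ N a -> A a^-1.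

(** A module squeezed between two finitely generated ones whose quotient is
    killed by [N] is a subspace of a finite-dimensional space over the residue
    field [A / N], hence finitely generated: the generators [ys] of the quotient
    are traded one by one for elements of [I]. *)
Lemma span_between I xs ys : ideal A I ->
  (forall n y, N n -> y \in ys -> span A xs (n * y)) ->
  (forall x, x \in xs -> I x) -> I `<=` span A (ys ++ xs) ->
  exists s, I = span A s.
Proof.
move=> idI; elim: ys xs => [|y ys IH] xs kill Ixs sI.
  by exists xs; apply/seteqP; split=> //; exact: span_sub_ideal.
have [sI'|/existsNP[z /not_implyP[Iz nz]]] := pselect (I `<=` span A (ys ++ xs)).
  by apply: IH sI' => // n y' Nn y'ys; apply: kill => //; rewrite inE y'ys orbT.
have [a [w [Aa ws zE]]] := sI _ Iz.
have sxs t : span A xs `<=` span A (t ++ xs).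
  by apply: span_sub_span => // x xxs; apply: mem_span => //; rewrite mem_cat xxs orbT.
have nNa : ~ N a.
  move=> Na; apply: nz; rewrite zE; apply: spanD => //; apply: sxs.
  by apply: kill => //; exact: mem_head.
have a0 : a != 0 by apply/eqP => a0; apply: nNa; rewrite a0; exact: ideal0 idN.
have sz : span A (ys ++ xs) `<=` span A (ys ++ z :: xs).
  apply: span_sub_span => // x; rewrite mem_cat => xin; apply: mem_span => //.
  by rewrite mem_cat inE; case/orP: xin => ->; rewrite ?orbT.
apply: (IH (z :: xs)).
- move=> n y' Nn y'ys; apply: (@span_sub_span _ _ xs) => //.
    by move=> x xxs; apply: mem_span => //; rewrite inE xxs orbT.
  by apply: kill => //; rewrite inE y'ys orbT.
- by move=> x; rewrite inE => /predU1P[->|/Ixs].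
- apply: (subset_trans sI); apply: span_sub_span => // x /=.
  rewrite inE => /predU1P[->|xin]; last by apply: sz; exact: mem_span.
  have -> : y = a^-1 * (z + (-1) * w) by rewrite zE; field.
  apply: spanM => //; first exact: unitA.
  apply: spanD => //; first by apply: mem_span => //; rewrite mem_cat mem_head orbT.
  by apply: spanM => //; [apply: subringN => //; exact: subring1 | exact: sz].
Qed.

(** The special case of the Eakin-Nagata theorem in which the maximal ideal of
    [A] is an ideal of the finite extension [B]. *)
Lemma noetherian_descent bs :
  B = span A bs -> noetherian B -> noetherian A.
Proof.
move=> BE /(noetherianP ringB) noethB; apply/(noetherianP ringA) => I idI.
pose IB := [set x | exists2 s, (forall y, y \in s -> I y) & span B s x].
have idIB : ideal B IB.
  split.
  - move=> x [s Is]; apply: (@span_min _ _ _ B).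
    + exact: subring0.
    + by move=> *; exact: subringD.
    + by move=> *; exact: subringM.
    + by move=> y /Is /(ideal_sub idI) /sAB.
  - by exists [::].
  - move=> x y [s Is sx] [t It ty]; exists (s ++ t).
      by move=> z; rewrite mem_cat => /orP[/Is|/It].
    apply: spanD => //.
      by apply: span_sub_span sx => // z zs; apply: mem_span; rewrite // mem_cat zs.
    by apply: span_sub_span ty => // z zs; apply: mem_span; rewrite // mem_cat zs orbT.
  - by move=> a x Ba [s Is sx]; exists s => //; exact: spanM.
have [g IBE] := noethB _ idIB.
have [xs Ixs sIB] : exists2 xs, (forall y, y \in xs -> I y) & IB `<=` span B xs.
  rewrite IBE; have : forall y, y \in g -> IB y by move=> y yg; rewrite IBE; exact: mem_span.
  elim: {IBE} g => [|y g IH] IBg.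
    by exists [::].
  have [|xs Ixs gxs] := IH; first by move=> z zg; apply: IBg; rewrite inE zg orbT.
  have [t It ty] := IBg y (mem_head _ _); exists (t ++ xs).
    by move=> z; rewrite mem_cat => /orP[/It|/Ixs].
  apply: span_sub_span => // z; rewrite inE => /predU1P[->|zg].
    by apply: span_sub_span ty => // u ut; apply: mem_span; rewrite // mem_cat ut.
  have := gxs z (mem_span ringB zg).
  by apply: span_sub_span => // u uxs; apply: mem_span; rewrite // mem_cat uxs orbT.
(* [I] lies between the [A]-span of [xs] and that of [ys], the latter being
   [I * B]; and [N * B] is contained in [A]. *)
pose ys := [seq b * x | b <- bs, x <- xs].
apply: (@span_between I xs ys) => //.
  move=> n _ Nn /allpairsP[[b x] /= [bbs xxs ->]]; rewrite mulrA.
  apply: spanM => //; last exact: mem_span.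
  by apply: sNA; apply: (idealMr idN) => //; rewrite BE; exact: mem_span.
move=> x Ix; apply: (@span_sub_span _ _ ys) => //.
  by move=> y yys; apply: mem_span; rewrite // mem_cat yys.
apply: (span_tower BE); apply: sIB.
by exists [:: x]; [move=> y; rewrite inE => /eqP -> | exact/mem_span/mem_head].
Qed.

End Descent.
End NoetherianTransfer.

(** * Subrings of a local domain containing its maximal ideal *)

Section LocalOverring.
Variables (F : fieldType) (A B N : set F).
Hypotheses (ringA : subring A) (ringB : subring B) (sAB : A `<=` B).
Hypotheses (locB : local_domain B N) (sNA : N `<=` A).
Hypothesis nzN : exists2 n, N n & n != 0.
Implicit Types P Q : set F.

Let prBN : prime_ideal B N := locB.1.
Let idN : ideal B N := prime_ideal_ideal prBN.

Let notN_neq0 s : ~ N s -> s != 0.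
Proof. by move=> nNs; apply/eqP => s0; apply: nNs; rewrite s0; exact: ideal0 idN. Qed.

Lemma maximal_prime_subring : prime_ideal A N.
Proof.
have <- : N `&` A = N by apply/seteqP; split=> [x []|x Nx] //; split=> //; exact: sNA.
exact: prime_ideal_contract sAB ringB prBN.
Qed.

(** Elements of [A] outside [N] are units of [B], so [N = s * N]. *)
Lemma ideal_dominates Q s : prime_ideal A Q -> A s -> ~ N s -> Q s -> N `<=` Q.
Proof.
move=> prQ As nNs Qs n Nn.
have -> : n = s^-1 * n * s by rewrite mulrAC mulVf ?notN_neq0 // mul1r.
apply: (idealM (prime_ideal_ideal prQ)) => //; apply: sNA.
by apply: (idealM idN) => //; apply: locB.2 => //; exact: sAB.
Qed.

Lemma loc_intersection_inv (PP : set (set F)) s :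
  A = loc_intersection PP A -> A s -> s != 0 ->
  (forall Q, PP Q -> ~ Q s) -> A s^-1.
Proof.
move=> AE As s0 nQs; rewrite AE; split=> [|Q /nQs nQ].
  by exists 1, s; rewrite mul1r; split=> //; [exact: subring1 | exact/eqP].
by exists 1, s; rewrite mul1r; split=> //; exact: subring1.
Qed.

(** A nonunit [s] would lie in a height-one prime, which then contains [N], hence
    is equal to it. *)
Lemma weakly_krull_units s : weakly_krull A -> A s -> ~ N s -> A s^-1.
Proof.
move=> [AE _] As nNs; apply: (loc_intersection_inv AE) => //.
  exact: notN_neq0.
move=> Q /(height_one_primesP _ ringA)[prQ _ minQ] Qs.
have sNQ := ideal_dominates prQ As nNs Qs; have [n Nn n0] := nzN.
have [/(_ n Nn)/eqP|sQN] := minQ _ maximal_prime_subring sNQ.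
  by rewrite (negPf n0).
exact/nNs/sQN.
Qed.

Lemma loc_intersection_above (PP : set (set F)) :
  A = loc_intersection PP A -> (forall Q, PP Q -> prime_ideal A Q) -> A <> B ->
  exists2 Q, PP Q & N `<=` Q.
Proof.
move=> AE prPP neqAB; apply: contrapT => nPP; apply: neqAB.
apply: (shared_ideal_loc_intersection sAB idN sNA nzN AE) => // Q PPQ sNQ.
by apply: nPP; exists Q.
Qed.

Lemma weakly_krull_minimal :
  weakly_krull A -> A <> B -> minimal_nonzero_prime A N.
Proof.
move=> [AE _] /(loc_intersection_above AE)[|Q ht1Q sNQ].
  by move=> Q [].
have minQ : minimal_nonzero_prime A Q by exact/height_one_primesP.
suff -> : N = Q by [].
have [n Nn n0] := nzN; apply/seteqP; split=> //.
case: minQ => _ _ /(_ _ maximal_prime_subring sNQ)[/(_ n Nn)/eqP|//].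
by rewrite (negPf n0).
Qed.

Lemma localization_above Q : N `<=` Q -> localization A Q `<=` B.
Proof.
move=> sNQ _ [a [s [Aa As nQs ->]]]; apply: (subringM ringB); first exact: sAB.
by apply: locB.2; [exact: sAB | move=> /sNQ].
Qed.

Lemma krull_type_valuation_above : krull_type A -> A <> B ->
  exists Q, [/\ prime_ideal A Q, N `<=` Q & valuation_domain (localization A Q)].
Proof.
move=> [PP [prPP AE valPP _]] /(loc_intersection_above AE)[//|Q PPQ sNQ].
by exists Q; split=> //; [exact: prPP | exact: valPP].
Qed.

(** Finitely many members of the defining family contain a fixed nonzero element
    of [N]. If [P] were not among them, prime avoidance would yield [x] in [P]
    outside [N] and outside all of them; as primes not containing [N] lie in [N],
    [x] would be inverted everywhere, hence in [A]. *)
Lemma krull_type_local P :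
  krull_type A -> local_domain A P -> ~ P `<=` N -> valuation_domain A.
Proof.
move=> [PP [prPP AE valPP fcPP]] locP nPN; have [prP _] := locP.
have [PPP|nPPP] := pselect (PP P).
  by have := valPP _ PPP; rewrite localization_at_maximal.
have [n Nn n0] := nzN.
have /finite_seqP[s sE] := fcPP n (sNA Nn) (elimN eqP n0).
have idP := prime_ideal_ideal prP.
have [|x Px xs] := @prime_avoidance _ _ ringA P (N :: s) idP.
  move=> Q; rewrite inE => /predU1P[->|Qs].
    by split=> //; exact: maximal_prime_subring.
  have [PPQ Qn] : [set Q | PP Q /\ Q n] Q by rewrite sE.
  split; first exact: prPP.
  move=> sPQ; apply: nPPP; suff -> : P = Q by [].
  by apply/seteqP; split=> //; apply: (prime_sub_maximal ringA locP); exact: prPP.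
have nNx : ~ N x by apply: xs; exact: mem_head.
have Ax := ideal_sub idP Px.
suff Ax' : A x^-1.
  case: (prime_not1 ringA prP); rewrite -(mulVf (notN_neq0 nNx)).
  exact: (idealM idP).
apply: (loc_intersection_inv AE) => //; first exact: notN_neq0.
move=> Q PPQ Qx; have sNQ := ideal_dominates (prPP _ PPQ) Ax nNx Qx.
have Qs : Q \in s.
  have : [set` s] Q by rewrite -sE; split=> //; exact: sNQ.
  by [].
by apply: (xs Q) => //; rewrite inE Qs orbT.
Qed.

End LocalOverring.

(** * Valuation domains *)

Section Valuation.
Variable F : fieldType.
Implicit Types S : set F.

Lemma quotient_field_total S S' : S `<=` S' -> quotient_field S = setT ->
  quotient_field S' = setT.
Proof.
move=> sSS' qS; apply/seteqP; split=> // x _.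
have [a [s [Sa Ss s0 ->]]] : quotient_field S x by rewrite qS.
by exists a, s; split=> //; exact: sSS'.
Qed.

(** Of two elements one divides the other, so a finite family is generated by
    one of its members. *)
Lemma bezout_valuation S : subring S -> valuation_domain S -> bezout S.
Proof.
move=> ringS valS n a Sa.
have dvd x y : S x -> S y -> (exists2 r, S r & x = r * y) \/ (exists2 r, S r & y = r * x).
  move=> Sx Sy; have [->|x0] := eqVneq x 0.
    by left; exists 0; rewrite ?mul0r //; exact: subring0.
  have [->|y0] := eqVneq y 0.
    by right; exists 0; rewrite ?mul0r //; exact: subring0.
  case: (valS (x / y)).
  - by exists x, y; split=> //; exact/eqP.
  - by apply/eqP; rewrite mulf_neq0 ?invr_eq0.
  - by left; exists (x / y); rewrite ?divfK.
  - by rewrite invf_div; right; exists (y / x); rewrite ?divfK.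
rewrite lin_span_span //.
have : forall x, x \in [seq a i | i <- enum 'I_n] -> S x by move=> _ /mapP[i _ ->].
elim: {a Sa} [seq _ | _ <- _] => [|x s IH] Ss.
  exists 0; first exact: subring0.
  apply/seteqP; split=> [_ ->|_ [r _ <-]]; last by rewrite mulr0.
  by exists 0; rewrite ?mulr0 //; exact: subring0.
have Sx : S x by apply: Ss; exact: mem_head.
have [|b Sb sE] := IH; first by move=> y ys; apply: Ss; rewrite inE ys orbT.
have [[r Sr xE]|[r Sr bE]] := dvd x b Sx Sb.
- exists b => //; apply/seteqP; split=> [y /= [c [z [Sc]]]|_ [c Sc <-]].
    rewrite sE => -[d Sd <-] ->; exists (c * r + d).
      by apply: (subringD ringS) => //; exact: subringM.
    by rewrite xE; ring.
  exists 0, (c * b); rewrite mul0r add0r sE; split=> //; first exact: subring0.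
  by exists c.
- exists x => //; apply/seteqP; split=> [y /= [c [z [Sc]]]|_ [c Sc <-]].
    rewrite sE => -[d Sd <-] ->; exists (c + d * r).
      by apply: (subringD ringS) => //; exact: subringM.
    by rewrite bE; ring.
  by exists c, 0; rewrite addr0; split=> //; exact: span0.
Qed.

(** If [a, b] generate [d] then [1] is a combination of [a / d] and [b / d], so
    one of these is a unit of the local domain. *)
Lemma valuation_bezout_local S N :
  subring S -> local_domain S N -> bezout S -> valuation_domain S.
Proof.
move=> ringS [prN unitS] bezS _ [a [b [Sa Sb /eqP b0 ->]]] /eqP.
rewrite mulf_eq0 invr_eq0 negb_or => /andP[a0 _].
pose c := nth 0 [:: a; b].
have [|d Sd] := bezS 2 (fun i => c i); first by case=> -[|[]].
rewrite -(span_lin_span [:: a; b]) // => abE.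
have mem_ab x : x \in [:: a; b] -> exists2 r, S r & r * d = x.
  by move=> xab; have : span S [:: a; b] x by [exact: mem_span]; rewrite abE => -[r]; exists r.
have [u Su uE] := mem_ab a (mem_head _ _).
have [|v Sv vE] := mem_ab b; first by rewrite !inE eqxx orbT.
have d0 : d != 0 by apply: contraNneq a0 => d0; rewrite -uE d0 mulr0.
have : span S [:: a; b] d by rewrite abE; exists 1; rewrite ?mul1r //; exact: subring1.
move=> [r [_ [Sr [t [_ [St -> ->]]] dE]]].
have uv1 : r * u + t * v = 1.
  by apply: (mulIf d0); rewrite mulrDl -!mulrA uE vE mul1r [RHS]dE addr0.
have uvE : a / b = u / v by rewrite -uE -vE -mulf_div divff ?mulr1.
have idN := prime_ideal_ideal prN.
have [Nv|nNv] := pselect (N v); last first.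
  by left; rewrite uvE; apply: (subringM ringS) => //; exact: unitS.
right; rewrite uvE invf_div; apply: (subringM ringS) => //; apply: unitS => // Nu.
by apply: (prime_not1 ringS prN); rewrite -uv1; apply: (idealD idN); apply: (idealM idN).
Qed.

End Valuation.

(** * Pullbacks along a residue map *)

Definition pullback (F K : Type) (g : F -> K) (S : set F) (E : set K) : set F :=
  [set x | S x /\ E (g x)].

(** Here [g] is the residue map of [T] at its maximal ideal [M], already extended
    to the localization [B] of [T] at [M]; it is a function on the whole field
    because the rings are subsets of it. *)
Section Pullback.
Variables (F K : fieldType) (g : F -> K) (T : set F) (D : set K).
Let M := pullback g T [set 0].
Let B := localization T M.
Let N := pullback g B [set 0].
Let R := pullback g T D.
Hypotheses (ringT : subring T) (ringD : subring D).
Hypothesis g1 : g 1 = 1.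
Hypothesis gB : forall x y, B x -> B y -> g (x - y) = g x - g y.
Hypothesis gM : forall x y, B x -> B y -> g (x * y) = g x * g y.
Hypothesis gsurj : forall y, exists2 x, T x & g x = y.
Hypothesis nzM : exists2 m, M m & m != 0.
Hypothesis properD : D <> setT.
Hypothesis fracT : quotient_field T = setT.

Let sTB : T `<=` B.
Proof.
move=> x Tx; exists x, 1; split=> //; last by rewrite divr1.
  exact: subring1.
by case=> _ /eqP; rewrite g1 oner_eq0.
Qed.

Let g0 : g 0 = 0.
Proof. by have B1 := sTB (subring1 ringT); rewrite -(subrr 1) gB // subrr. Qed.

Let gN x : B x -> g (- x) = - g x.
Proof.
by move=> Bx; rewrite -sub0r gB ?g0 ?sub0r //; exact: sTB (subring0 ringT).
Qed.

Lemma residue_kernel_prime : prime_ideal T M.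
Proof.
apply/(prime_idealP ringT); split.
- split.
  + by move=> x [].
  + by split; [exact: subring0 | exact: g0].
  + move=> x y [Tx /= gx] [Ty /= gy]; split; first exact: subringD.
    rewrite -[y]opprK gB; [|exact: sTB|by apply: sTB; exact: subringN].
    by rewrite gN; [rewrite /= gx gy !oppr0 addr0 | exact: sTB]. 
  + move=> a x Ta [Tx /= gx]; split; first exact: subringM.
    by rewrite gM ?gx ?mulr0 //; exact: sTB.
- by case=> _ /eqP; rewrite g1 oner_eq0.
- move=> a b Ta Tb [_]; rewrite gM; [|exact: sTB|exact: sTB].
  by move=> /eqP; rewrite mulf_eq0 => /orP[]/eqP gab; [left|right].
Qed.

Let prM := residue_kernel_prime.

Let ringB : subring B. Proof. exact: localization_subring. Qed.

Let gD x y : B x -> B y -> g (x + y) = g x + g y.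
Proof.
move=> Bx By; rewrite -[y]opprK gB ?gN ?opprK //; first exact: subringN.
exact: subringN.
Qed.

Let gdiv a s : T a -> T s -> ~ M s -> g s != 0 /\ g (a / s) = g a / g s.
Proof.
move=> Ta Ts nMs.
have gs0 : g s != 0 by apply/eqP => gs; apply: nMs.
have s0 : s != 0 by apply: contraNneq gs0 => ->; rewrite g0.
have Bas : B (a / s) by exists a, s.
split=> //; apply: (mulIf gs0); rewrite -gM ?divfK //; exact: sTB.
Qed.

Let extM : ext_ideal T M M = N.
Proof.
apply/seteqP; split=> [_ [a [s [[Ta /= ga] Ts nMs ->]]]|x [[a [s [Ta Ts nMs xE]]]]].
  split; first by exists a, s.
  by have [_ ->] := gdiv Ta Ts nMs; rewrite ga mul0r.
have [gs0 gas] := gdiv Ta Ts nMs.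
rewrite xE /= gas => /eqP; rewrite mulf_eq0 invr_eq0 (negPf gs0) orbF => /eqP ga.
by exists a, s.
Qed.

Let locB : local_domain B N.
Proof. by rewrite -extM; exact: localization_local. Qed.

Let gV x : B x -> g x != 0 -> B x^-1 /\ g x^-1 = (g x)^-1.
Proof.
move=> Bx gx0; have Bx' : B x^-1 by apply: locB.2 => // -[_ /eqP]; exact/negP.
split=> //; have x0 : x != 0 by apply: contraNneq gx0 => ->; rewrite g0.
by apply: (mulfI gx0); rewrite -gM // !mulfV.
Qed.

(** Any unit of [K] lifts, so an element of [B] has a denominator with any
    prescribed nonzero residue. *)
Let denominator x c : B x -> c != 0 -> exists t u,
  [/\ T t, T u, g u = c, u != 0 & x = t / u].
Proof.
move=> [a [s [Ta Ts nMs xE]]] c0; have [gs0 _] := gdiv Ta Ts nMs.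
have [v Tv gv] := gsurj (c / g s).
have s0 : s != 0 by apply: contraNneq gs0 => ->; rewrite g0.
have v0 : v != 0.
  by apply: contra_eq_neq gv => ->; rewrite g0 eq_sym mulf_neq0 ?invr_eq0.
exists (a * v), (s * v); split; try exact: subringM.
- by rewrite gM ?gv ?(mulrCA (g s)) ?divff ?mulr1 //; exact: sTB.
- exact: mulf_neq0.
- by rewrite xE -mulf_div divff ?mulr1.
Qed.

Let maxM t : T t -> ~ M t -> exists2 u, T u & M (1 - t * u).
Proof.
move=> Tt nMt; have gt0 : g t != 0 by apply/eqP => gt; exact: nMt.
have [u Tu gu] := gsurj (g t)^-1; exists u => //.
have Ttu : T (t * u) by exact: subringM.
split; first by apply: (subringB ringT) => //; exact: subring1.
rewrite /= gB ?g1; [|exact: sTB (subring1 ringT)|exact: sTB].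
by rewrite gM ?gu ?mulfV ?subrr //; exact: sTB.
Qed.

Let prime_above_maximal Q : prime_ideal T Q -> M `<=` Q -> Q = M.
Proof.
move=> prQ sMQ; have idQ := prime_ideal_ideal prQ.
apply/seteqP; split=> // t Qt; apply: contrapT => nMt.
have [u Tu /sMQ Q1] := maxM (ideal_sub idQ Qt) nMt.
apply: (prime_not1 ringT prQ); rewrite -(subrK (t * u) 1).
by apply: (idealD idQ) => //; exact: (idealMr idQ).
Qed.

Section OverB.
Variable E : set K.
Hypothesis ringE : subring E.

Lemma pullback_subring : subring (pullback g B E).
Proof.
split; first by split; [exact: subring1 | rewrite g1; exact: subring1].
- move=> x y [Bx Ex] [By Ey]; split; first exact: subringB.
  by rewrite gB //; exact: subringB.
- move=> x y [Bx Ex] [By Ey]; split; first exact: subringM.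
  by rewrite gM //; exact: subringM.
Qed.

Let sub_pullback : pullback g B E `<=` B. Proof. by move=> x []. Qed.

Let maximal_sub_pullback : N `<=` pullback g B E.
Proof. by move=> x [Bx /= gx]; split=> //; rewrite gx; exact: subring0. Qed.

Lemma pullback_full : pullback g B E = B <-> E = setT.
Proof.
split=> [EB|->]; last by apply/seteqP; split=> x; [case | move=> Bx; split].
apply/seteqP; split=> // y _; have [x /sTB Bx <-] := gsurj y.
have [_ //] : pullback g B E x by rewrite EB.
Qed.

Let nzN : exists2 n, N n & n != 0.
Proof.
by have [m [Tm gm] m0] := nzM; exists m => //; split=> //; exact: sTB.
Qed.

Lemma weakly_krull_pullback_inv x :
  weakly_krull (pullback g B E) -> E x -> x != 0 -> E x^-1.
Proof.
move=> wk Ex x0; have [t Tt gt] := gsurj x; have Bt := sTB Tt.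
have gt0 : g t != 0 by rewrite gt.
have [_ gtV] := gV Bt gt0.
have := @weakly_krull_units _ _ _ _ pullback_subring ringB sub_pullback locB
  maximal_sub_pullback nzN t wk.
case; first by split=> //; rewrite gt.
  by move=> [_ /eqP]; exact/negP.
by rewrite gtV gt.
Qed.

Lemma weakly_krull_pullback_minimal : weakly_krull (pullback g B E) ->
  E <> setT -> minimal_nonzero_prime (pullback g B E) N.
Proof.
move=> wk neqE; apply: (weakly_krull_minimal pullback_subring ringB) => //.
by move/pullback_full.
Qed.

Let fracE : quotient_field (pullback g B E) = setT.
Proof.
apply/seteqP; split=> // x _; have [m Mm m0] := nzM.
have [a [s [Ta Ts s0 ->]]] : quotient_field T x by rewrite fracT.
have mem t : T t -> pullback g B E (t * m).
  move=> Tt; apply: maximal_sub_pullback; have [Tm gm] := Mm.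
  split; first by apply/sTB; exact: subringM.
  by rewrite /= gM ?gm ?mulr0 //; exact: sTB.
exists (a * m), (s * m); split; [exact: mem|exact: mem| |].
  by apply/eqP; rewrite mulf_neq0 //; exact/eqP.
by rewrite -mulf_div divff ?mulr1.
Qed.

(** A localization of [pullback g B E] at a prime above [N] is contained in [B]
    and its residues are fractions of elements of [E]. *)
Lemma krull_type_pullback_valuation : krull_type (pullback g B E) -> E <> setT ->
  (forall x, B x \/ B x^-1) /\ quotient_field E = setT.
Proof.
move=> kt neqE.
have [|Q [prQ sNQ valQ]] := krull_type_valuation_above sub_pullback locB
    maximal_sub_pullback nzN kt.
  by move/pullback_full.
have sQB := localization_above ringB sub_pullback locB sNQ.
have val x : x != 0 ->
    localization (pullback g B E) Q x \/ localization (pullback g B E) Q x^-1.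
  move=> x0; apply: valQ; last exact/eqP.
  by rewrite (quotient_field_total (sub_localization pullback_subring prQ) fracE).
split=> [x|].
  have [->|/val[/sQB|/sQB]] := eqVneq x 0; [left|by left|by right].
  exact: subring0.
have resE z : localization (pullback g B E) Q z -> quotient_field E (g z).
  move=> [a [s [[Ba Ea] [Bs Es] nQs zE]]].
  have gs0 : g s != 0 by apply/eqP => gs; apply/nQs/sNQ.
  exists (g a), (g s); split=> //; first exact/eqP.
  have s0 : s != 0 by apply: contraNneq gs0 => ->; rewrite g0.
  have Bz : B z by rewrite zE; apply: (subringM ringB) => //; case: (gV Bs gs0).
  by rewrite -[a](divfK s0) -zE gM // mulfK.
apply/seteqP; split=> // y _; have [x Tx gx] := gsurj y.
have [->|y0] := eqVneq y 0.
  exists 0, 1; rewrite mul0r; split=> //; [exact: subring0 | exact: subring1|].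
  by apply/eqP; rewrite oner_eq0.
have gx0 : g x != 0 by rewrite gx.
have [|/resE|/resE] := val x; first by apply: contraNneq gx0 => ->; rewrite g0.
  by rewrite gx.
have [_ ->] := gV (sTB Tx) gx0; rewrite gx => -[a [s [Ea Es s0 yE]]].
have sa : y = s / a by rewrite -[y]invrK yE invf_div.
exists s, a; split=> // a0; case/eqP: y0.
by rewrite sa a0 invr0 mulr0.
Qed.

(** The residue of a unit [x] of [B] decides which of [x] and [x^-1] is in the
    pullback; if [x] is not a unit of [B], one of them is in [N]. *)
Lemma valuation_pullback : (forall x, B x \/ B x^-1) ->
  (forall y, y != 0 -> E y \/ E y^-1) -> valuation_domain (pullback g B E).
Proof.
move=> valB valE x _ /eqP x0.
wlog Bx : x x0 / B x.
  move=> wl; case: (valB x) => [|Bx]; first exact: wl.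
  by have := wl _ _ Bx; rewrite invrK invr_eq0 => /(_ x0) []; [right|left].
have [gx|gx0] := eqVneq (g x) 0.
  by left; split=> //; rewrite gx; exact: subring0.
have [Bx' gx'] := gV Bx gx0.
case: (valE _ gx0) => Egx; [left | right]; split=> //.
by rewrite gx'.
Qed.

Lemma pullback_valuation :
  valuation_domain (pullback g B E) -> forall y, y != 0 -> E y \/ E y^-1.
Proof.
move=> val y y0; have [x Tx gx] := gsurj y.
have gx0 : g x != 0 by rewrite gx.
have [_ gxV] := gV (sTB Tx) gx0.
case: (val x); [by rewrite fracE | | |].
- by move=> x0; case/eqP: gx0; rewrite x0 g0.
- by move=> [_]; rewrite gx; left.
- by move=> [_]; rewrite gxV gx; right.
Qed.

End OverB.

(** * Localizations of the pullback *)

Let sub_R : R `<=` T. Proof. by move=> x []. Qed.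

Let sMR : M `<=` R.
Proof. by move=> x [Tx /= gx]; split=> //; rewrite gx; exact: subring0. Qed.

Let ringR : subring R.
Proof.
split; first by split; [exact: subring1 | rewrite g1; exact: subring1].
- move=> x y [Tx Dx] [Ty Dy]; split; first exact: subringB.
  by rewrite gB; [exact: subringB | exact: sTB | exact: sTB].
- move=> x y [Tx Dx] [Ty Dy]; split; first exact: subringM.
  by rewrite gM; [exact: subringM | exact: sTB | exact: sTB].
Qed.

Let idM : ideal T M := prime_ideal_ideal prM.

Let prRM : prime_ideal R M.
Proof.
have <- : M `&` R = M by apply/seteqP; split=> [x []|x Mx] //; split=> //; exact: sMR.
exact: prime_ideal_contract sub_R ringT prM.
Qed.

Lemma pullback_prime p : prime_ideal D p -> prime_ideal R (pullback g T p).
Proof.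
move=> prp; have idp := prime_ideal_ideal prp; apply/(prime_idealP ringR); split.
- split.
  + by move=> x [Tx px]; split=> //; exact: ideal_sub idp _.
  + by split; [exact: subring0 | rewrite g0; exact: ideal0 idp].
  + move=> x y [Tx px] [Ty py]; split; first exact: subringD.
    by rewrite gD; [exact: (idealD idp) | exact: sTB | exact: sTB].
  + move=> a x [Ta Da] [Tx px]; split; first exact: subringM.
    by rewrite gM; [exact: (idealM idp) | exact: sTB | exact: sTB].
- by case=> _; rewrite g1; exact: (prime_not1 ringD).
- move=> a b [Ta Da] [Tb Db] [_]; rewrite gM; [|exact: sTB|exact: sTB].
  by case/(prime_mul prp Da Db); [left|right].
Qed.

Lemma prime_above_kernel P : prime_ideal R P -> M `<=` P ->
  exists2 p, prime_ideal D p & P = pullback g T p.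
Proof.
move=> prP sMP; have idP := prime_ideal_ideal prP.
have inP x : R x -> (exists2 x', P x' & g x' = g x) -> P x.
  move=> Rx [x' Px' gxx']; rewrite -(subrK x' x); apply: (idealD idP) => //.
  have [Tx _] := Rx; have [Tx' _] := ideal_sub idP Px'.
  apply: sMP; split; first exact: subringB.
  by rewrite /= gB ?gxx' ?subrr //; exact: sTB.
exists (g @` P).
  apply/(prime_idealP ringD); split.
  - split.
    + by move=> _ [x /(ideal_sub idP)[_ Dx] <-].
    + by exists 0; [exact: ideal0 idP | exact: g0].
    + move=> _ _ [x Px <-] [y Py <-]; exists (x + y); first exact: (idealD idP).
      by rewrite gD //; apply/sTB/sub_R; exact: ideal_sub idP _.
    + move=> a _ Da [x Px <-]; have [t Tt gt] := gsurj a.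
      exists (t * x); first by apply: (idealM idP) => //; split=> //; rewrite gt.
      by rewrite gM ?gt //; [exact: sTB | apply/sTB/sub_R; exact: ideal_sub idP _].
  - move=> [x Px gx]; apply: (prime_not1 ringR prP); apply: inP; first exact: subring1.
    by exists x; rewrite ?g1.
  - move=> a b Da Db [x Px gx].
    have [s Ts gs] := gsurj a; have [t Tt gt] := gsurj b.
    have Rs : R s by split; rewrite ?gs.
    have Rt : R t by split; rewrite ?gt.
    have : P (s * t).
      apply: inP; first exact: subringM.
      by exists x; rewrite // gM ?gs ?gt //; exact: sTB.
    by case/(prime_mul prP Rs Rt); [left; exists s | right; exists t].
apply/seteqP; split=> [x Px|x [Tx [x' Px' gxx']]].
  by split; [apply/sub_R; exact: ideal_sub idP _ | exists x].
apply: inP; last by exists x'.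
by split=> //; rewrite -gxx'; have [] := ideal_sub idP Px'.
Qed.

(** Localizing at a prime above [M] inverts all of [T] outside [M], because the
    denominators can be corrected to have their residue in [D]. *)
Lemma localization_pullback p : prime_ideal D p ->
  localization R (pullback g T p) = pullback g B (localization D p).
Proof.
move=> prp; apply/seteqP; split=> [_ [a [s [[Ta Da] [Ts Ds] nps ->]]]|x].
  have nMs : ~ M s.
    move=> [_ /= gs]; apply: nps; split=> //; rewrite gs.
    exact: ideal0 (prime_ideal_ideal prp).
  have [gs0 gas] := gdiv Ta Ts nMs; split; first by exists a, s.
  by exists (g a), (g s); split=> // pgs; apply: nps.
move=> [Bx [d [e [Dd De npe gx]]]].
have e0 : e != 0.
  apply/eqP => e0; apply: npe; rewrite e0.
  exact: ideal0 (prime_ideal_ideal prp).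
have [t [u [Tt Tu gu u0 xE]]] := denominator Bx e0.
have gt : g t = d.
  have -> : t = x * u by rewrite xE divfK.
  by rewrite gM ?gu ?gx ?divfK //; exact: sTB.
exists t, u; split=> //; [by split; rewrite ?gt | by split; rewrite ?gu |].
by move=> [_]; rewrite gu.
Qed.

Let ringDp p : prime_ideal D p -> subring (localization D p).
Proof. exact: localization_subring. Qed.

Let locally_away (X : set F -> Prop) : Prop :=
  forall Q, prime_ideal T Q -> ~ M `<=` Q -> X (localization T Q).

(** The primes of [R] not containing [M] contribute the same localizations as
    those of [T]. *)
Lemma locally_pullback (X : set F -> Prop) : locally X R <->
  locally_away X /\ forall p, prime_ideal D p -> X (pullback g B (localization D p)).
Proof.
split=> [lX|[awayX aboveX] P prP].
  split=> [Q prQ nMQ|p prp].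
    rewrite -(localization_shared sub_R idM sMR prQ nMQ); apply: lX.
    exact: prime_ideal_contract prQ.
  by rewrite -localization_pullback //; apply/lX/pullback_prime.
have [sMP|nMP] := pselect (M `<=` P).
  have [p prp ->] := prime_above_kernel prP sMP.
  by rewrite localization_pullback //; exact: aboveX.
have [Q [prQ nMQ ->]] := shared_ideal_localization ringT sub_R idM sMR prP nMP.
exact: awayX.
Qed.

Lemma locally_residue (X : set F -> Prop) : locally X T <-> locally_away X /\ X B.
Proof.
split=> [lX|[awayX XB] Q prQ].
  by split=> [Q prQ _|]; exact: lX.
have [/(prime_above_maximal prQ) ->//|nMQ] := pselect (M `<=` Q).
exact: awayX.
Qed.

Let pr0 : prime_ideal D [set 0]. Proof. exact: prime_ideal_zero. Qed.

Lemma field_prime_ideal p : is_field D -> prime_ideal D p -> p = [set 0].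
Proof.
move=> fieldD prp; have idp := prime_ideal_ideal prp.
apply/seteqP; split=> [x px|_ ->]; last exact: ideal0 idp.
apply: contrapT => /eqP x0; apply: (prime_not1 ringD prp).
have Dx := ideal_sub idp px; rewrite -(mulVf x0); apply: (idealM idp) => //.
by apply: fieldD => //; exact/eqP.
Qed.

Lemma field_localization : is_field D -> localization D [set 0] = D.
Proof. by move=> fieldD; apply: localization_at_maximal. Qed.

Let prime_not_field x : D x -> x != 0 -> ~ D x^-1 ->
  exists2 p, prime_ideal D p & ~ localization D p x^-1.
Proof.
move=> Dx x0 nDx'.
have [r Dr xr|p prp px] := @prime_ideal_exists _ D x ringD Dx.
  by apply: nDx'; rewrite -(mulKf x0 r) xr mulr1 in Dr.
exists p => // -[a [s [Da Ds nps x'E]]]; apply: nps.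
have s0 : s != 0.
  by apply: contraNneq x0 => s0; rewrite -[x]invrK x'E s0 invr0 mulr0 invr0.
have -> : s = a * x by rewrite -[x]invrK x'E invf_div mulrCA divff ?mulr1 //;
  apply: contraNneq x0 => a0; rewrite -[x]invrK x'E a0 mul0r invr0.
exact: (idealM (prime_ideal_ideal prp)).
Qed.

(** The zero ideal of [D] will do when [D] is a field; otherwise any prime
    containing a nonunit. *)
Lemma proper_localization_exists :
  exists2 p, prime_ideal D p & localization D p <> setT.
Proof.
have [fieldD|] := pselect (is_field D).
  by exists [set 0] => //; rewrite field_localization.
move=> /existsNP[x /not_implyP[Dx /not_implyP[/eqP x0 nDx']]].
have [p prp npx'] := prime_not_field Dx x0 nDx'.
by exists p => // pE; apply: npx'; rewrite pE.
Qed.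

Let extRM : ext_ideal R M M = N.
Proof.
apply/seteqP; split=> [_ [a [s [[Ta /= ga] [Ts _] nMs ->]]]|x [Bx /= gx]].
  have [_ gas] := gdiv Ta Ts nMs.
  by split; [exists a, s | rewrite /= gas ga mul0r].
have [t [u [Tt Tu gu u0 xE]]] := denominator Bx (oner_neq0 K).
have gt : g t = 0.
  have -> : t = x * u by rewrite xE divfK.
  by rewrite gM ?gx ?mul0r //; exact: sTB.
exists t, u; split=> //.
  by split=> //; rewrite gu; exact: subring1.
by move=> [_ /= /eqP]; rewrite gu oner_eq0.
Qed.

Lemma minimal_nonzero_prime_residue :
  minimal_nonzero_prime T M <-> minimal_nonzero_prime B N.
Proof. by rewrite -extM; exact: minimal_nonzero_prime_localization. Qed.

Lemma minimal_nonzero_prime_pullback : minimal_nonzero_prime T M <->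
  minimal_nonzero_prime (pullback g B (localization D [set 0])) N.
Proof.
rewrite -(localization_pullback pr0) -extRM.
rewrite -(minimal_nonzero_prime_localization ringR prRM).
apply: (minimal_nonzero_prime_shared ringR ringT sub_R idM sMR maxM) => //.
exact: prime_not1 prM.
Qed.

Let local_field_pullback : is_field D -> local_domain (pullback g B D) N.
Proof.
move=> fieldD; split.
  apply: (maximal_prime_subring (pullback_subring ringD) ringB _ locB).
    by move=> x [].
  by move=> x [Bx /= gx]; split=> //; rewrite gx; exact: subring0.
move=> x [Bx Dx] nNx; have gx0 : g x != 0 by apply/eqP => gx; exact: nNx.
have [Bx' gx'] := gV Bx gx0; split=> //; rewrite gx'.
by apply: fieldD => //; exact/eqP.
Qed.

Let local_localization_pullback p : prime_ideal D p ->
  local_domain (pullback g B (localization D p))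
    (ext_ideal R (pullback g T p) (pullback g T p)).
Proof.
move=> prp; rewrite -(localization_pullback prp).
by apply: localization_local => //; exact: pullback_prime.
Qed.

(** * The three transfer theorems *)

Lemma residue_span (E : set K) (s : seq F) :
  subring E -> (forall x, x \in s -> B x) ->
  g @` span (pullback g B E) s = span E [seq g x | x <- s].
Proof.
move=> ringE; have ringA := pullback_subring ringE.
elim: s => [|x s IH] sB.
  apply/seteqP; split=> [_ [_ -> <-]|_ ->]; first exact: g0.
  by exists 0; rewrite ?g0.
have Bx : B x by apply: sB; exact: mem_head.
have {}sB y : y \in s -> B y by move=> ys; apply: sB; rewrite inE ys orbT.
have spanB : span (pullback g B E) s `<=` B.
  apply: span_min => //; [exact: subring0 | by move=> *; exact: subringD |].
  by move=> a z [Ba _] Bz; exact: subringM.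
apply/seteqP; split=> [_ [y /= [a [z [[Ba Ea] sz ->]]] <-]|y /= [c [w [Ec]]]].
  exists (g a), (g z); rewrite gD ?gM //; [|exact: subringM|exact: spanB].
  by split=> //; rewrite -IH //; exists z.
rewrite -IH // => -[z sz <-] ->; have [a Ta ga] := gsurj c.
have Ba := sTB Ta; exists (a * x + z).
  by exists a, z; split=> //; split=> //; rewrite ga.
by rewrite gD ?gM ?ga //; [exact: subringM | exact: spanB].
Qed.

Lemma locally_field_pullback (X : set F -> Prop) : is_field D ->
  (forall p, prime_ideal D p -> X (pullback g B (localization D p))) <->
  X (pullback g B D).
Proof.
move=> fieldD; split=> [/(_ _ pr0)|XD p prp]; first by rewrite field_localization.
by rewrite (field_prime_ideal fieldD prp) field_localization.
Qed.

Let minimal_field : is_field D ->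
  minimal_nonzero_prime T M <-> minimal_nonzero_prime (pullback g B D) N.
Proof.
by move=> fieldD; rewrite minimal_nonzero_prime_pullback field_localization.
Qed.

Lemma locally_weakly_krull_pullback : locally (@weakly_krull _) R <->
  [/\ is_field D, locally (@weakly_krull _) T & minimal_nonzero_prime T M].
Proof.
split=> [/locally_pullback[away above]|].
  have fieldD : is_field D.
    move=> x Dx /eqP x0; apply: contrapT => nDx'.
    have [p prp npx'] := prime_not_field Dx x0 nDx'; apply: npx'.
    apply: (weakly_krull_pullback_inv (ringDp prp) (above _ prp)) => //.
    exact: sub_localization.
  have minM : minimal_nonzero_prime T M.
    apply/(minimal_field fieldD).
    apply: (weakly_krull_pullback_minimal ringD) => //.
    exact/(locally_field_pullback _ fieldD).
  split=> //; apply/locally_residue; split=> //.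
  apply: (weakly_krull_local ringB locB).
  exact/minimal_nonzero_prime_residue.
move=> [fieldD /locally_residue[away _] minM]; apply/locally_pullback.
split=> //; apply/(locally_field_pullback _ fieldD).
apply: (weakly_krull_local (pullback_subring ringD) (local_field_pullback fieldD)).
exact/minimal_field.
Qed.

Lemma infra_krull_weakly_krull (S : set F) : infra_krull S -> weakly_krull S.
Proof. by case. Qed.

Lemma locally_infra_krull_pullback : locally (@infra_krull _) R <->
  [/\ is_field D, locally (@infra_krull _) T, minimal_nonzero_prime T M
    & finite_degree (quotient_field D)].
Proof.
have qD : is_field D -> quotient_field D = D.
  by move=> fieldD; rewrite -[RHS]field_localization //.
have sDB : pullback g B D `<=` B by move=> x [].
have idN : ideal B N by case: locB => -[].
have sND : N `<=` pullback g B D.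
  by move=> x [Bx /= gx]; split=> //; rewrite gx; exact: subring0.
have ringA := pullback_subring ringD.
have infraP : is_field D -> minimal_nonzero_prime T M ->
    (infra_krull (pullback g B D) <-> noetherian (pullback g B D)) /\
    (infra_krull B <-> noetherian B).
  move=> fieldD minM; split.
    apply: (infra_krull_local ringA (local_field_pullback fieldD)).
    exact/minimal_field.
  apply: (infra_krull_local ringB locB).
  exact/minimal_nonzero_prime_residue.
split=> [infraR|].
  have [fieldD _ minM] : [/\ is_field D, locally (@weakly_krull _) T
      & minimal_nonzero_prime T M].
    apply/locally_weakly_krull_pullback => P prP.
    exact/infra_krull_weakly_krull/infraR.
  have [infraA infraB] := infraP fieldD minM.
  have [away /(locally_field_pullback _ fieldD)/infraA noethA] :=
    (locally_pullback _).1 infraR.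
  have [n [Tn /= gn] n0] := nzM.
  have nB b : B b -> pullback g B D (n * b).
    move=> Bb; apply: sND; split; first by apply: (subringM ringB) => //; exact: sTB.
    by rewrite /= gM ?gn ?mul0r //; exact: sTB.
  split=> //.
    apply/locally_residue; split=> //; apply/infraB.
    exact: noetherian_overring n0 nB noethA.
  have idB : ideal B B.
    split=> //; [exact: subring0 | by move=> *; exact: subringD |].
    by move=> *; exact: subringM.
  have [s BE] := ideal_span_noetherian ringA sDB n0 nB noethA idB.
  have sB x : x \in s -> B x by move=> xs; rewrite BE; exact: mem_span.
  have gsE : span D [seq g x | x <- s] = setT.
    rewrite -residue_span // -BE; apply/seteqP; split=> // y _.
    by have [x Tx gx] := gsurj y; exists x; [exact: sTB | exact: gx].
  rewrite qD //; move: gsE; rewrite span_lin_span // => gsE.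
  by exists (size [seq g x | x <- s]), (fun i => [seq g x | x <- s]`_i).
move=> [fieldD /locally_residue[away infraB] minM [n [e]]].
rewrite qD // lin_span_span // => eE.
have [infraA noethB] := infraP fieldD minM.
apply/locally_pullback; split=> //; apply/(locally_field_pullback _ fieldD).
apply/infraA; have {}noethB := noethB.1 infraB.
have [s sT gsE] : exists2 s, (forall x, x \in s -> T x) &
    [seq g x | x <- s] = [seq e i | i <- enum 'I_n].
  elim: {eE} [seq e i | i <- enum 'I_n] => [|y t [s sT gsE]]; first by exists [::].
  have [x Tx gx] := gsurj y; exists (x :: s); last by rewrite /= gx gsE.
  by move=> z; rewrite inE => /predU1P[->|/sT].
have sB x : x \in s -> B x by move=> /sT /sTB.
have s1B x : x \in 1 :: s -> B x.
  by rewrite inE => /predU1P[->|/sB//]; exact: subring1.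
have spanB : span (pullback g B D) (1 :: s) `<=` B.
  apply: span_min => //; [exact: subring0 | by move=> *; exact: subringD |].
  by move=> a z [Ba _] Bz; exact: subringM.
have BE : B = span (pullback g B D) (1 :: s).
  apply/seteqP; split=> // x Bx.
  (* Correct [x] by an element with the same residue in the span of [s]; the
     difference lies in [N], so it is a scalar times the generator [1]. *)
  have [z sz gz] : (g @` span (pullback g B D) s) (g x).
    by rewrite residue_span // gsE eE.
  exists (x - z), z; rewrite mulr1 subrK; split=> //; apply: sND.
  have Bz : B z.
    by apply: spanB; exists 0, z; rewrite mul0r add0r; split=> //; exact: subring0.
  by split; [exact: subringB | rewrite /= gB // gz subrr].
have unitA a : pullback g B D a -> ~ N a -> pullback g B D a^-1.
  exact: (local_field_pullback fieldD).2.
exact: (noetherian_descent ringA ringB sDB idN sND unitA BE).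
Qed.

Lemma locally_krull_type_pullback : locally (@krull_type _) R <->
  [/\ locally (@bezout _) D, locally (@krull_type _) T, valuation_domain B
    & quotient_field D = setT].
Proof.
have total x : quotient_field B x.
  by rewrite (quotient_field_total sTB fracT).
have valP : (forall x, B x \/ B x^-1) <-> valuation_domain B.
  split=> [val x _ _|val x]; first exact: val.
  have [->|x0] := eqVneq x 0; first by left; exact: subring0.
  by apply: val => //; exact/eqP.
have above0 p : prime_ideal D p -> [set 0] `<=` p.
  by move=> prp _ ->; exact: ideal0 (prime_ideal_ideal prp).
split=> [/locally_pullback[away above]|].
  have [q prq neq] := proper_localization_exists.
  have [valB fracDq] := krull_type_pullback_valuation (ringDp prq) (above _ prq) neq.
  have fracD : quotient_field D = setT.
    apply/seteqP; split=> // x _.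
    have [_ [_ [[a [s [Da Ds nqs ->]]] [b [t [Db Dt nqt ->]]] /eqP + ->]]] :
      quotient_field (localization D q) x by rewrite fracDq.
    rewrite mulf_eq0 invr_eq0 negb_or => /andP[b0 t0].
    have s0 : s != 0 by apply/eqP => s0; apply: nqs; rewrite s0; exact: above0.
    exists (a * t), (s * b); split; try exact: subringM.
      by apply/eqP; rewrite mulf_neq0.
    by rewrite invf_div mulf_div.
  have D0 : localization D [set 0] = setT by rewrite -fracD; apply/seteqP; split.
  have BE : pullback g B (localization D [set 0]) = B.
    by rewrite D0; apply/seteqP; split=> [x []|].
  split=> //; last first.
    by apply/locally_residue; split=> //; rewrite -BE; exact: above.
  move=> p prp; apply: (bezout_valuation (ringDp prp)) => y _ /eqP y0.
  have idp := prime_ideal_ideal prp.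
  have [p0|/existsNP[c /not_implyP[pc /eqP c0]]] := pselect (p `<=` [set 0]).
    by left; rewrite (_ : p = [set 0]) ?D0 //; apply/seteqP; split=> //; exact: above0.
  apply: (pullback_valuation (ringDp prp)) => //.
  have sDpB : pullback g B (localization D p) `<=` B by move=> x [].
  have sNDp : N `<=` pullback g B (localization D p).
    move=> x [Bx /= gx]; split=> //; rewrite gx.
    exact: (subring0 (ringDp prp)).
  have nzN : exists2 n, N n & n != 0.
    by have [m [Tm gm] m0] := nzM; exists m => //; split=> //; exact: sTB.
  apply: (krull_type_local (pullback_subring (ringDp prp)) ringB sDpB locB sNDp nzN
    (above _ prp) (local_localization_pullback prp)).
  have [t Tt gt] := gsurj c.
  move=> /(_ t) []; last by rewrite /= gt => _ /eqP; exact/negP.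
  apply: (sub_ext_ideal ringR (pullback_prime prp)).
  by split=> //; rewrite gt.
move=> [bezD /locally_residue[away _] /valP valB fracD].
apply/locally_pullback; split=> // p prp.
apply: (krull_type_local_valuation (pullback_subring (ringDp prp))
  (local_localization_pullback prp)).
apply: (valuation_pullback (ringDp prp)) => // y /eqP y0.
apply: (valuation_bezout_local (ringDp prp) (localization_local ringD prp)) => //.
  exact: bezD.
by rewrite (quotient_field_total (sub_localization ringD prp) fracD).
Qed.

End Pullback.

(** * Transport to the fraction field *)

Section Quotient.
Import FracField.
Local Open Scope quotient_scope.
Lemma fraction_quotient (T : idomainType) (x : {fraction T}) :
  exists a s, s != 0 /\ x = @tofrac T a / @tofrac T s.
Proof.
elim/quotW: x => y; exists (frac y).1, (frac y).2; have y0 := denom_ratioP y.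
split=> //; have y0' : tofrac (frac y).2 != 0 by rewrite tofrac_eq0.
apply: (mulIf y0'); rewrite divfK //.
unlock tofrac; rewrite -[LHS]pi_mul; apply/eqmodP; rewrite /= equivfE /mulf.
by rewrite !numden_Ratio ?mulr1 ?oner_eq0 // mulrC.
Qed.

End Quotient.

Section FractionField.
Variable T : idomainType.
Implicit Types P : set T.
Notation "x %:F" := (@tofrac T x).
Notation T' := (in_frac [set: T]).

Lemma tofrac_inj : injective (@tofrac T).
Proof. by move=> x y /eqP; rewrite tofrac_eq => /eqP. Qed.

Lemma in_fracE P x : in_frac P x%:F <-> P x.
Proof. by split=> [[y Py /tofrac_inj <-]|Px] //; exists x. Qed.

Lemma in_fracT x : T' x%:F. Proof. exact/in_fracE. Qed.

Lemma in_frac_subring : subring T'.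
Proof.
split; first by exists 1; rewrite ?tofrac1.
- by move=> _ _ [x _ <-] [y _ <-]; rewrite -tofracB; exact: in_fracT.
- by move=> _ _ [x _ <-] [y _ <-]; rewrite -tofracM; exact: in_fracT.
Qed.

Lemma quotient_field_in_frac : quotient_field T' = setT.
Proof.
apply/seteqP; split=> // x _; have [a [s [s0 ->]]] := fraction_quotient x.
exists a%:F, s%:F; split; [exact: in_fracT|exact: in_fracT| |by []].
by apply/eqP; rewrite tofrac_eq0.
Qed.

Lemma in_frac_prime P : prime_ideal setT P <-> prime_ideal T' (in_frac P).
Proof.
have ringT : subring [set: T] by split.
split=> [prP|prP].
  have idP := prime_ideal_ideal prP.
  apply/(prime_idealP in_frac_subring); split.
  - split.
    + by move=> _ [x _ <-]; exact: in_fracT.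
    + by exists 0; [exact: ideal0 idP | rewrite tofrac0].
    + move=> _ _ [x Px <-] [y Py <-]; rewrite -tofracD; apply/in_fracE.
      exact: (idealD idP).
    + move=> _ _ [a _ <-] [x Px <-]; rewrite -tofracM; apply/in_fracE.
      exact: (idealM idP).
  - by rewrite -tofrac1 => /in_fracE; exact: (prime_not1 ringT).
  - move=> _ _ [a _ <-] [b _ <-]; rewrite -tofracM => /in_fracE.
    by case/(prime_mul prP I I) => ?; [left|right]; exact/in_fracE.
have idP := prime_ideal_ideal prP.
apply/(prime_idealP ringT); split.
- split=> //.
  + by apply/in_fracE; rewrite tofrac0; exact: ideal0 idP.
  + by move=> x y /in_fracE Px /in_fracE Py; apply/in_fracE; rewrite tofracD; exact: (idealD idP).
  + move=> a x _ /in_fracE Px; apply/in_fracE; rewrite tofracM.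
    by apply: (idealM idP) => //; exact: in_fracT.
- by move/in_fracE; rewrite tofrac1; exact: (prime_not1 in_frac_subring).
- move=> a b _ _ /in_fracE; rewrite tofracM.
  by case/(prime_mul prP (in_fracT a) (in_fracT b)) => /in_fracE; [left|right].
Qed.

Lemma in_frac_preimage (Q : set {fraction T}) :
  Q `<=` T' -> exists P, Q = in_frac P.
Proof.
move=> sQT; exists [set t | Q t%:F]; apply/seteqP; split=> [y Qy|_ [t Qt <-] //].
by have [t _ tE] := sQT _ Qy; exists t => //=; rewrite tE.
Qed.

Lemma in_frac_sub P Q : in_frac P `<=` in_frac Q <-> P `<=` Q.
Proof.
split=> [sPQ x Px|sPQ _ [x Px <-]]; apply/in_fracE; last exact: sPQ.
by apply: sPQ; exact/in_fracE.
Qed.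

Lemma in_frac0 : in_frac [set (0 : T)] = [set 0].
Proof. by rewrite /in_frac image_set1 tofrac0. Qed.

Lemma in_frac_minimal_nonzero_prime P :
  minimal_nonzero_prime setT P <-> minimal_nonzero_prime T' (in_frac P).
Proof.
split=> -[prP [x Px x0] minP]; split.
- exact/in_frac_prime.
- by exists x%:F; [exact/in_fracE | rewrite tofrac_eq0].
- move=> Q prQ; have idQ := prime_ideal_ideal prQ.
  have [Q0 QE] := in_frac_preimage (fun y => @ideal_sub _ _ _ y idQ).
  move: prQ; rewrite QE -in_frac0 => /in_frac_prime prQ0 /in_frac_sub sQP.
  by case: (minP _ prQ0 sQP) => ?; [left|right]; exact/in_frac_sub.
- exact/in_frac_prime.
- by case: Px x0 => t Pt <-; rewrite tofrac_eq0; exists t.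
- move=> Q /in_frac_prime prQ /in_frac_sub sQP.
  by case: (minP _ prQ sQP); rewrite -?in_frac0 => /in_frac_sub; [left|right].
Qed.

(** The extension of [phi] to the localization of [T] at its kernel: the
    quotient of the residues does not depend on the fraction chosen. *)
Definition residue (K : fieldType) (phi : T -> K) (x : {fraction T}) : K :=
  xget 0 [set y | exists a s, [/\ phi s != 0, x = a%:F / s%:F & y = phi a / phi s]].

Lemma residueE (K : fieldType) (phi : {rmorphism T -> K}) a s :
  phi s != 0 -> residue phi (a%:F / s%:F) = phi a / phi s.
Proof.
move=> s0; apply: xget_unique; first by exists a, s.
move=> y [b [t [t0 abE ->]]].
have tofrac_neq0 u : phi u != 0 -> u%:F != 0.
  by rewrite tofrac_eq0; apply: contraNneq => ->; rewrite rmorph0.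
have /tofrac_inj/(congr1 phi) : (a * t)%:F = (b * s)%:F.
  by apply/eqP; rewrite !tofracM -eqr_div ?tofrac_neq0 //; apply/eqP.
by rewrite !rmorphM => /eqP; rewrite -eqr_div // => /eqP.
Qed.

Lemma residue_tofrac (K : fieldType) (phi : {rmorphism T -> K}) a :
  residue phi a%:F = phi a.
Proof.
by rewrite -[a%:F]divr1 -tofrac1 residueE rmorph1 ?oner_neq0 ?divr1.
Qed.

Lemma in_frac_pullback (K : fieldType) (phi : {rmorphism T -> K}) (E : set K) :
  in_frac (phi @^-1` E) = pullback (residue phi) T' E.
Proof.
apply/seteqP; split=> [_ [x Ex <-]|_ [[x _ <-] Ex]].
  by split; [exact: in_fracT | rewrite residue_tofrac].
by exists x => //; rewrite residue_tofrac in Ex.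
Qed.

End FractionField.

Theorem theorem3p8 (T : idomainType) (M : set T) (K : fieldType)
    (phi : {rmorphism T -> K}) (D : set K)
    (hM : maximal_ideal [set: T] M)
    (hM0 : M <> [set 0])
    (hsurj : range phi = [set: K])
    (hker : phi @^-1` [set 0] = M)
    (hD : subring_closed [in D])
    (hproper : D <> [set: K]) :
  let k := quotient_field D in
  let R := in_frac (phi @^-1` D) in
  let T' := in_frac [set: T] in
  let M' := in_frac M in
  [/\ locally (@weakly_krull _) R <->
        [/\ is_field D, locally (@weakly_krull _) T'
          & height_eq [set: T] M 1%N],
      locally (@infra_krull _) R <->
        [/\ is_field D, locally (@infra_krull _) T',
            height_eq [set: T] M 1%N & finite_degree k]
    & locally (@krull_type _) R <->
        [/\ locally (@bezout _) D, locally (@krull_type _) T',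
            valuation_domain (localization T' M') & k = [set: K]]].
Proof.
move=> k R T' M'.
have ringD : subring D.
  have [D1 DB DM] := hD; split=> [|x y Dx Dy|x y Dx Dy]; apply/set_mem => //.
    by apply: DB; exact/mem_set.
  by apply: DM; exact/mem_set.
pose g := residue phi.
have M'E : M' = pullback g T' [set 0] by rewrite /M' -hker in_frac_pullback.
have RE : R = pullback g T' D by exact: in_frac_pullback.
have ringT' : subring T' by exact: in_frac_subring.
have g1 : g 1 = 1 by rewrite -tofrac1 /g residue_tofrac rmorph1.
have locP x : localization T' (pullback g T' [set 0]) x ->
    exists a s, phi s != 0 /\ x = tofrac a / tofrac s.
  move=> [_ [_ [[a _ <-] [s _ <-] nMs ->]]]; exists a, s; split=> //.
  apply/eqP => s0; apply: nMs; split; first exact: in_fracT.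
  by rewrite /= /g residue_tofrac.
have tofrac_neq0 u : phi u != 0 -> tofrac u != 0.
  by rewrite tofrac_eq0; apply: contraNneq => ->; rewrite rmorph0.
have gB x y : localization T' (pullback g T' [set 0]) x ->
    localization T' (pullback g T' [set 0]) y -> g (x - y) = g x - g y.
  move=> /locP[a [s [s0 ->]]] /locP[b [t [t0 ->]]].
  have -> : tofrac a / tofrac s - tofrac b / tofrac t =
      tofrac (a * t - b * s) / tofrac (s * t).
    by rewrite -mulNr addf_div ?tofrac_neq0 // mulNr -!tofracM -tofracB.
  rewrite /g !residueE ?rmorphB ?rmorphM ?mulf_neq0 //=.
  by field; rewrite s0 t0.
have gM x y : localization T' (pullback g T' [set 0]) x ->
    localization T' (pullback g T' [set 0]) y -> g (x * y) = g x * g y.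
  move=> /locP[a [s [s0 ->]]] /locP[b [t [t0 ->]]].
  rewrite mulf_div -!tofracM /g !residueE ?rmorphM ?mulf_neq0 //.
  by rewrite mulf_div.
have gsurj y : exists2 x, T' x & g x = y.
  have [x _ <-] : range phi y by rewrite hsurj.
  by exists (tofrac x); [exact: in_fracT | exact: residue_tofrac].
have nzM : exists2 m, pullback g T' [set 0] m & m != 0.
  apply: contrapT => nM; apply: hM0; apply/seteqP; split=> [x Mx|_ ->].
    apply: contrapT => /eqP x0; apply: nM; exists (tofrac x).
      by rewrite -M'E; exact/in_fracE.
    by rewrite tofrac_eq0.
  by case: hM => -[].
have htM : height_eq [set: T] M 1%N <->
    minimal_nonzero_prime T' (pullback g T' [set 0]).
  rewrite -M'E -in_frac_minimal_nonzero_prime; apply: height_eq1P.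
  by split.
have fracT := quotient_field_in_frac T.
rewrite M'E RE (propext htM); split.
- exact: locally_weakly_krull_pullback.
- exact: locally_infra_krull_pullback.
- exact: locally_krull_type_pullback.
Qed.
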